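(* Let $0<T<\infty$, let $E, X, Y, Z$ be separable Banach spaces, and let $V$ be a separable and reflexive Banach space with norm $\|\cdot\|$ and duality brackets $\langle\cdot,\cdot\rangle$ between $V^*$ and $V$. Let $A\colon[0,T]\times E\times V\to V^*$, $f\colon[0,T]\times X\to V^*$, $\varphi\colon[0,T]\times Y\times V\times V\to\mathbb{R}$, $j\colon[0,T]\times Z\times X\to\mathbb{R}$, $K\subset V$, $M\colon V\to X$, $R_1\colon L^2(0,T;V)\to L^2(0,T;E)$, $R_2\colon L^2(0,T;V)\to L^2(0,T;X)$, $R_3\colon L^2(0,T;V)\to L^2(0,T;Y)$, $R_4\colon L^2(0,T;V)\to L^2(0,T;Z)$ satisfy all of the following. (1) Operator $A$: (a) $A(\cdot,\cdot,v)$ is continuous for all $v\in V$; (b) $\|A(t,\lambda,v)\|_{V^*}\le a_0(t)+a_1\|\lambda\|_E+a_2\|v\|$ for all $t\in[0,T]$, $\lambda\in E$, $v\in V$, with $a_0\in C(0,T)_+$ and $a_1,a_2\ge0$; (c) $A(t,\lambda,\cdot)$ is demicontinuous for all $t\in[0,T]$, $\lambda\in E$; (d) $\langle A(t,\lambda_1,v_1)-A(t,\lambda_2,v_2),v_1-v_2\rangle\ge m_A\|v_1-v_2\|^2-\bar m_A\|\lambda_1-\lambda_2\|_E\|v_1-v_2\|$ for all $t\in[0,T]$, $\lambda_1,\lambda_2\in E$, $v_1,v_2\in V$, with $m_A>0$, $\bar m_A\ge0$. (2) Function $f$: $f(\cdot,\xi)$ is continuous for all $\xi\in X$, and $\|f(t,\xi_1)-f(t,\xi_2)\|_{V^*}\le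 L_f\|\xi_1-\xi_2\|_X$ for all $t\in[0,T]$, $\xi_1,\xi_2\in X$, with $L_f>0$. (3) Function $\varphi$: (a) $\varphi(t,\eta,w,\cdot)$ is convex and lower semicontinuous for all $t\in[0,T]$, $\eta\in Y$, $w\in V$; (b) $\varphi(t,\eta_1,w_1,v_2)-\varphi(t,\eta_1,w_1,v_1)+\varphi(t,\eta_2,w_2,v_1)-\varphi(t,\eta_2,w_2,v_2)\le\alpha_\varphi\|w_1-w_2\|\|v_1-v_2\|+\beta_\varphi\|\eta_1-\eta_2\|_Y\|v_1-v_2\|$ for all $t\in[0,T]$, $\eta_1,\eta_2\in Y$, $w_1,w_2,v_1,v_2\in V$, with $\alpha_\varphi,\beta_\varphi\ge0$; (c) $\varphi(t,\eta,w,v_1)-\varphi(t,\eta,w,v_2)\le\big(c_{\varphi_1}(t)+c_{\varphi_2}(\|w\|)+c_3\|\eta\|_Y\big)\|v_1-v_2\|$ for all $(t,\eta,w)\in[0,T]\times Y\times V$, $v_1,v_2\in V$, where $c_{\varphi_1}\colon[0,T]\to[0,\infty)$ and $c_{\varphi_2}\colon[0,\infty)\to[0,\infty)$ are continuous functions and $c_3>0$; (d) $\limsup\big(\varphi(t_n,\eta_n,w_n,v)-\varphi(t_n,\eta_n,w_n,w_n)\big)\le\varphi(t,\eta,w,v)-\varphi(t,\eta,w,w)$ for any $v\in V$, $t_n\to t$ in $[0,T]$, $\eta_n\to\eta$ in $Y$ and $w_n\rightharpoonup w$ (weakly) in $V$. (4) Function $j$: (a) $j(\cdot,\cdot,v)$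 is continuous for all $v\in X$; (b) $j(t,\zeta,\cdot)$ is locally Lipschitz for all $t\in[0,T]$, $\zeta\in Z$; (c) $\|\partial j(t,\zeta,v)\|_{X^*}\le c_{0j}(t)+c_{1j}\|\zeta\|_Z+c_{2j}\|v\|_X$ for all $t\in[0,T]$, $\zeta\in Z$, $v\in X$, with $c_{0j}\in C(0,T)_+$ and $c_{1j},c_{2j}\ge0$; (d) $j^0(t,\zeta_1,v_1;v_2-v_1)+j^0(t,\zeta_2,v_2;v_1-v_2)\le m_j\|v_1-v_2\|_X^2+m_1\|\zeta_1-\zeta_2\|_Z\|v_1-v_2\|_X$ for all $t\in[0,T]$, $\zeta_1,\zeta_2\in Z$, $v_1,v_2\in X$, with $m_j,m_1\ge0$; (e) $\limsup j^0(t_n,\zeta_n,Mv;Mv-Mw_n)\le j^0(t,\zeta,Mv;Mv-Mw)$ for any $v\in V$, $t_n\to t$ in $[0,T]$, $\zeta_n\to\zeta$ in $Z$ and $w_n\rightharpoonup w$ (weakly) in $V$. (5) $K$ is a nonempty, closed and convex subset of $V$. (6) $M\colon V\to X$ is a linear, bounded and compact operator. (7) There are constants $c_{R_1},c_{R_2},c_{R_3},c_{R_4}>0$ such that, for $i=1,2,3,4$, with $W_1=E$, $W_2=X$, $W_3=Y$, $W_4=Z$, $$\|(R_iv_1)(t)-(R_iv_2)(t)\|_{W_i}\le c_{R_i}\int_0^t\|v_1(s)-v_2(s)\|\,ds\quad\text{for all }v_1,v_2\in L^2(0,T;V),\ \text{a.e. }t\in(0,T).$$ (8) $m_j\|M\|^2+\alpha_\varphi<m_A$.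 Then there exists a unique $w\in L^2(0,T;V)$ such that $w(t)\in K$ for a.e. $t\in(0,T)$ and $$\langle A(t,(R_1w)(t),w(t))-f(t,(R_2w)(t)),v-w(t)\rangle+\varphi(t,(R_3w)(t),w(t),v)-\varphi(t,(R_3w)(t),w(t),w(t))+j^0(t,(R_4w)(t),Mw(t);Mv-Mw(t))\ge0$$ for all $v\in K$ and a.e. $t\in(0,T)$.
   Context: All Banach spaces are real. $C(0,T)$ denotes the space of continuous real functions on $[0,T]$ and $C(0,T)_+$ its nonnegative elements. $\|M\|$ is the operator norm in $\mathcal{L}(V,X)$. An operator $B\colon V\to V^*$ is demicontinuous if it is continuous from the strong topology of $V$ to the weak topology of $V^*$. For a locally Lipschitz function $\psi\colon X\to\mathbb{R}$ on a Banach space $X$, the generalized (Clarke) directional derivative at $x\in X$ in the direction $v\in X$ is $\psi^0(x;v)=\limsup_{y\to x,\ \lambda\downarrow0}\frac{\psi(y+\lambda v)-\psi(y)}{\lambda}$, and the generalized (Clarke) subgradient is $\partial\psi(x)=\{x^*\in X^*\mid\langle x^*,v\rangle\le\psi^0(x;v)\text{ for all }v\in X\}$. The symbols $\partial j(t,\zeta,v)$ and $j^0(t,\zeta,v;z)$ denote the generalized subgradient and the generalized directional derivative (at $v$ in direction $z$) of $j$ with respect to its last variable, i.e. of $j(t,\zeta,\cdot)$. For a set $S$ in a normed space, $\|S\|=\sup\{\|u\|\mid u\in S\}$. *)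

(* Defs.v *)
From HB Require Import structures.
From mathcomp Require Import all_boot all_order all_algebra.
From mathcomp Require Import all_classical all_reals all_analysis.

Set Implicit Arguments.
Unset Strict Implicit.
Unset Printing Implicit Defensive.

Import Order.TTheory GRing.Theory Num.Theory.
Import numFieldNormedType.Exports.

Local Open Scope classical_set_scope.
Local Open Scope ring_scope.

Definition separable (T : topologicalType) :=
  exists2 D : set T, countable D & dense D.

Section BoundedLinear.
Context {R : realType} (V W : normedModType R).

Definition bounded_linear_pred : {pred V -> W} :=
  [pred f | `[< linear f /\ continuous f >]].

Lemma bounded_linear_submod_closed : submod_closed bounded_linear_pred.
Proof.
split=> [|a f g /asboolP[lf cf] /asboolP[lg cg]]; apply/asboolP; split.
- by move=> k x y; rewrite -[LHS]/(0 : W) -[RHS]/(k *: (0 : W) + 0) scaler0 addr0.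
- by move=> x; exact: cvg_cst.
- move=> k x y; rewrite -[LHS]/(a *: f (k *: x + y) + g (k *: x + y)).
  rewrite -[RHS]/(k *: (a *: f x + g x) + (a *: f y + g y)) lf lg !scalerDr !scalerA (mulrC a).
  by rewrite -!addrA; congr (_ + _); rewrite addrCA.
- by move=> x; apply: cvgD; [apply: cvgZr; exact: cf|exact: cg].
Qed.

HB.instance Definition _ :=
  GRing.isSubmodClosed.Build R (V -> W) bounded_linear_pred
    bounded_linear_submod_closed.

Record bounded_op := BoundedOp {
  bounded_op_fun :> V -> W;
  bounded_opP : bounded_op_fun \in bounded_linear_pred }.

HB.instance Definition _ := [isSub for bounded_op_fun].
HB.instance Definition _ := gen_eqMixin bounded_op.
HB.instance Definition _ := gen_choiceMixin bounded_op.
HB.instance Definition _ := [SubChoice_isSubLmodule of bounded_op by <:].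

Lemma bounded_op_linear (f : bounded_op) : linear f.
Proof. by have /asboolP[] := bounded_opP f. Qed.

HB.instance Definition _ (f : bounded_op) :=
  GRing.isLinear.Build R V W _ f (bounded_op_linear f).

Lemma bounded_op_continuous (f : bounded_op) : continuous f.
Proof. by have /asboolP[] := bounded_opP f. Qed.

Definition op_norm (f : bounded_op) : R :=
  sup [set `|f v| | v in [set v : V | `|v| <= 1]].

Lemma op_norm_has_sup (f : bounded_op) :
  has_sup [set `|f v| | v in [set v : V | `|v| <= 1]].
Proof.
split; first by exists `|f 0|, 0 => //=; rewrite normr0.
have /linear_boundedP := continuous_linear_bounded 0 (@bounded_op_continuous f 0).
move=> [M [Mreal fM]]; exists (`|M| + 1) => _ [v /= v1 <-].
have := fM (`|M| + 1); rewrite (le_lt_trans (ler_norm _)) ?ltrDl// => /(_ isT v).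
by move/le_trans; apply; rewrite ler_piMr// addr_ge0.
Qed.

Lemma op_norm_ub (f : bounded_op) v : `|v| <= 1 -> `|f v| <= op_norm f.
Proof.
by move=> v1; apply: ub_le_sup; [case: (op_norm_has_sup f)|exists v].
Qed.

Lemma op_norm_ge0 (f : bounded_op) : 0 <= op_norm f.
Proof. by apply: le_trans (@op_norm_ub f 0 _); rewrite ?normr0. Qed.

Lemma op_normP (f : bounded_op) v : `|f v| <= op_norm f * `|v|.
Proof.
have [->|v0] := eqVneq v 0; first by rewrite linear0 !normr0 mulr0.
have nv : 0 < `|v| by rewrite normr_gt0.
rewrite -ler_pdivrMr//.
have := @op_norm_ub f (`|v|^-1 *: v).
rewrite linearZ/= !normrZ ger0_norm ?invr_ge0// mulVf ?gt_eqF// => /(_ (lexx _)).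
by rewrite mulrC.
Qed.

Lemma op_norm_le (f : bounded_op) M :
  (forall v, `|v| <= 1 -> `|f v| <= M) -> op_norm f <= M.
Proof.
move=> fM; apply: ge_sup; first by case: (op_norm_has_sup f).
by move=> _ [v v1 <-]; exact: fM.
Qed.

Lemma op_normD (f g : bounded_op) : op_norm (f + g) <= op_norm f + op_norm g.
Proof.
apply: op_norm_le => v v1; apply: (le_trans (ler_normD (f v) (g v))).
by apply: lerD; exact: op_norm_ub.
Qed.

Lemma op_normZ_le (k : R) (f : bounded_op) : op_norm (k *: f) <= `|k| * op_norm f.
Proof.
apply: op_norm_le => v v1; have -> : (k *: f) v = k *: f v by [].
by rewrite normrZ ler_wpM2l// op_norm_ub.
Qed.

Lemma op_normZ (k : R) (f : bounded_op) : op_norm (k *: f) = `|k| * op_norm f.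
Proof.
have [->|k0] := eqVneq k 0.
  rewrite normr0 mul0r; apply/eqP; rewrite eq_le op_norm_ge0 andbT.
  by apply: (le_trans (op_normZ_le _ _)); rewrite normr0 mul0r.
apply/eqP; rewrite eq_le op_normZ_le/=.
rewrite -ler_pdivlMl ?normr_gt0// -normfV.
by apply: (le_trans _ (op_normZ_le _ _)); rewrite scalerA mulVf// scale1r.
Qed.

Lemma op_norm0_eq0 (f : bounded_op) : op_norm f = 0 -> f = 0.
Proof.
move=> f0; apply: val_inj; apply/funext => v; apply/normr0_eq0/eqP.
by rewrite eq_le normr_ge0 andbT (le_trans (op_normP f v))// f0 mul0r.
Qed.

HB.instance Definition _ :=
  Lmodule_isNormed.Build R bounded_op op_normD op_normZ op_norm0_eq0.

Definition compact_op (f : bounded_op) :=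
  forall B : set V, bounded_set B -> precompact (f @` B).

End BoundedLinear.

Notation dual R V := (@bounded_op R V R^o).

Definition pairing {R : realType} {V : normedModType R} (f : dual R V) (v : V)
  : R := f v.
Notation "<| f , v |>" := (pairing f v)
  (at level 0, f at level 99, v at level 99, format "<|  f ,  v  |>") : ring_scope.

Definition reflexive_space {R : realType} (V : normedModType R) :=
  forall F : dual R (dual R V), exists v : V, forall f : dual R V, F f = f v.

Definition weak_topology {R : realType} (V : normedModType R) : Type :=
  sup_topology (fun f : dual R V =>
    Topological.class (initial_topology (f : V -> R^o))).

HB.instance Definition _ {R : realType} (V : normedModType R) :=
  Topological.on (weak_topology V).

Definition weak_cvg {R : realType} {V : normedModType R} (w_ : nat -> V) (w : V) :=
  (w_ : nat -> weak_topology V) @ \oo --> (w : weak_topology V).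

Lemma weak_cvgP {R : realType} {V : normedModType R} (w_ : nat -> V) (w : V) :
  weak_cvg w_ w <-> forall f : dual R V, f \o w_ @ \oo --> f w.
Proof.
split=> [/cvg_sup wf f|wf]; last apply/cvg_sup => f.
  move=> A fA; have := wf f (f @^-1` A); apply.
  exact: (@initial_continuous _ _ (f : V -> R^o) w A fA).
move=> A; rewrite /= (@nbhsE (initial_topology (f : V -> R^o))).
move=> [_ [[C Cop <-] Cw] CA]; have := wf f C (open_nbhs_nbhs (conj Cop Cw)).
by move=> [N _ NC]; exists N => // n /NC; exact: CA.
Qed.

Definition demicontinuous {R : realType} {V : normedModType R} (B : V -> dual R V) :=
  continuous (B : V -> weak_topology (dual R V)).

Lemma demicontinuousP {R : realType} {V : normedModType R} (B : V -> dual R V) :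
  demicontinuous B <-> forall F : dual R (dual R V), continuous (F \o B).
Proof.
split=> [cB F v|FB v]; last apply/cvg_sup => F.
  have /cvg_sup/(_ F) wF := cB v.
  move=> C FC; have := wF (F @^-1` C); apply.
  exact: (@initial_continuous _ _ (F : dual R V -> R^o) (B v) C FC).
move=> A; rewrite /= (@nbhsE (initial_topology (F : dual R V -> R^o))).
move=> [_ [[C Cop <-] Cw] CA]; have := FB F v C (open_nbhs_nbhs (conj Cop Cw)).
by apply: (@filterS _ (nbhs v)) => x; exact: CA.
Qed.

Section Clarke.
Context {R : realType} {X : normedModType R}.

Definition locally_lipschitz (psi : X -> R) :=
  forall x : X, exists2 U : set X, nbhs x U & [lipschitz (psi y : R^o) | y in U].

(** The upper limit is taken in the extended reals; it is finite when [psi] is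
    locally Lipschitz, and only such [psi] are considered. *)
Definition clarke_deriv (psi : X -> R) (x v : X) : R :=
  fine (limf_esup
    (fun p : X * R => ((psi (p.1 + p.2 *: v) - psi p.1) / p.2)%:E)
    (filter_prod (nbhs x) (0 : R)^'+)).

Definition clarke_subdiff (psi : X -> R) (x : X) : set (dual R X) :=
  [set xs | forall v, <| xs, v |> <= clarke_deriv psi x v].

End Clarke.

Definition set_norm {R : realType} {X : normedModType R} (S : set X) : \bar R :=
  ereal_sup [set (`|u|)%:E | u in S].

Section BochnerL2.
Context {R : realType}.
Local Notation mu := (@lebesgue_measure R).

Definition simple_fun {V : Type} (s : R -> V) :=
  finite_set (range s) /\ forall v, measurable (s @^-1` [set v]).

(** An almost everywhere limit of simple functions agrees almost everywhere with
    such a pointwise limit, so the classes in [L2] are the usual ones. *)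
Definition strongly_measurable {V : normedModType R} (D : set R) (u : R -> V) :=
  exists2 s : nat -> R -> V, forall n, simple_fun (s n) &
    forall t, D t -> s ^~ t @ \oo --> u t.

Definition sq_integrable {V : normedModType R} (D : set R) (u : R -> V) :=
  strongly_measurable D u /\ (\int[mu]_(t in D) (`|u t| ^+ 2)%:E < +oo)%E.

Context (T : R) (V : normedModType R).

Record L2fun := MkL2fun {
  L2fun_val :> R -> V;
  L2funP : sq_integrable `]0, T[%classic L2fun_val }.

HB.instance Definition _ := gen_eqMixin L2fun.
HB.instance Definition _ := gen_choiceMixin L2fun.

(** [L2] is the Lebesgue-Bochner space L^2(0,T;V): classes of functions modulo
    equality almost everywhere on ]0,T[. *)
Definition L2_eq (u v : L2fun) := `[< u = v %[ae mu in `]0, T[%classic ] >].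

Let L2_eq_refl : reflexive L2_eq.
Proof. by move=> u; apply/asboolP; exact: aeW. Qed.

Let L2_eq_sym : symmetric L2_eq.
Proof.
by move=> u v; apply/idP/idP => /asboolP uv; apply/asboolP; exact: ae_eq_sym.
Qed.

Let L2_eq_trans : transitive L2_eq.
Proof.
by move=> v u w /asboolP uv /asboolP vw; apply/asboolP; exact: ae_eq_trans uv vw.
Qed.

Canonical L2_eq_canonical := EquivRel L2_eq L2_eq_refl L2_eq_sym L2_eq_trans.

Local Open Scope quotient_scope.

Definition L2 : Type := {eq_quot L2_eq}.
HB.instance Definition _ := Choice.on L2.
HB.instance Definition _ := EqQuotient.on L2.

(** An element of [L2] is evaluated through a chosen representative, so only
    statements holding for almost every t in ]0,T[ are meaningful. *)
Definition L2_repr (u : L2) : L2fun := repr u.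

Lemma L2_eqP (u v : L2) :
  u = v <-> L2_repr u = L2_repr v %[ae mu in `]0, T[%classic].
Proof.
split=> [->|uv]; first exact: aeW.
by rewrite -[u]reprK -[v]reprK; apply/eqmodP/asboolP.
Qed.

End BochnerL2.

Coercion L2_repr : L2 >-> L2fun.

(* Main.v *)
(** For fixed time and fixed values [p] of the four history terms the inequality
    is an equilibrium problem [0 <= G w v] for a strongly monotone bifunction [G],
    convex in [v].  Its Minty form [G v w <= 0] has a solution: finitely many
    of these constraints are approximately solvable by a descent argument that
    moves towards barycenters (only monotonicity is used, not Brouwer's theorem),
    and ultralimits, which exist weakly by reflexivity, handle all constraints
    at once.  Strong monotonicity makes the solution [S t p] unique and
    Lipschitz in [p]; the limsup conditions, applied along weakly convergent
    subsequences, make [S] jointly sequentially continuous.  Hence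
    [w |-> S t (R1 w t, R2 w t, R3 w t, R4 w t)] maps L^2 to itself, the
    solutions are its fixed points, and it is a Volterra operator: it halves
    distances measured with an exponential weight, so Picard iteration gives
    exactly one fixed point. *)

Require Import Defs.
From HB Require Import structures.
From mathcomp Require Import all_boot all_order all_algebra.
From mathcomp Require Import all_classical all_reals all_analysis.
From mathcomp Require Import measurable_realfun.
From mathcomp Require Import ring lra.

Set Implicit Arguments.
Unset Strict Implicit.
Unset Printing Implicit Defensive.

Import Order.TTheory GRing.Theory Num.Theory.
Import numFieldNormedType.Exports.

Local Open Scope classical_set_scope.
Local Open Scope ring_scope.

(** * Hahn-Banach theorem *)

(** The obstacle is the weakness of the limits. Bounded solutions converge only weakly along
    subsequences, while [A] is merely demicontinuous in its last argument, so [A t_n p_n w_n] cannot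
    be followed in the inequality itself. In Minty form [A] and the Clarke derivative are evaluated
    at the fixed test point, and only the terms covered by the limsup hypotheses still contain
    [w_n]. Testing this form at the weak limit [w] also bounds m |w_n - w|^2 by a quantity tending
    to 0, which upgrades weak to strong convergence. Joint continuity of [S] is wanted, not just its
    Lipschitz bound in [p], because measurability of [S t (p t)] is obtained by approximating [t] as
    well as [p t] by simple functions. The constant m is what remains of [mA] after the defects
    [alpha_phi] and mj |M|^2 are subtracted; it is positive by the smallness condition. Uniqueness
    meets a question of quantifiers: a competitor satisfies the inequality for each [v] outside a
    null set depending on [v]. A sequence dense in [K] gives a common null set. *)

Definition sublinear {R : realType} {V : lmodType R} (p : V -> R) :=
  (forall x y, p (x + y) <= p x + p y) /\
  (forall k x, 0 < k -> p (k *: x) <= k * p x).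

Section HahnBanach.
Context {R : realType} {V : lmodType R}.
Implicit Types (p q : V -> R) (x y : V).

Lemma sublinear0 p : sublinear p -> p 0 = 0.
Proof.
move=> [_ ph]; have := ph 2 0 ltac:(lra); have := ph 2^-1 0 ltac:(lra).
rewrite !scaler0; lra.
Qed.

Lemma sublinearZ p k x : sublinear p -> 0 < k -> p (k *: x) = k * p x.
Proof.
move=> [_ ph] k0; apply/eqP; rewrite eq_le ph//=.
have := ph k^-1 (k *: x); rewrite invr_gt0 => /(_ k0).
by rewrite scalerA mulVf ?gt_eqF// scale1r -ler_pdivrMl ?invr_gt0// invrK.
Qed.

Lemma sublinearN p x : sublinear p -> - p (- x) <= p x.
Proof. by move=> sp; have := sp.1 x (- x); rewrite subrr sublinear0//; lra. Qed.

Let tightened p y x := [set p (x + s *: y) - s * p y | s in [set s | 0 <= s]].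
(** The largest sublinear function below [p] whose value at [- y] is at most [- p y]: any such q
    satisfies q x <= q (x + s y) + s q (- y) for all s >= 0. *)
Let tighten p y x := inf (tightened p y x).

Let tightened_lb p y x s : sublinear p -> 0 <= s ->
  - p (- x) <= p (x + s *: y) - s * p y.
Proof.
move=> sp; rewrite le_eqVlt => /predU1P[<-|s0].
  by rewrite scale0r mul0r addr0 subr0 sublinearN.
have := sp.1 (x + s *: y) (- x); rewrite [x + _]addrC addrK sublinearZ//; lra.
Qed.

Let tighten_has_inf p y x : sublinear p -> has_inf (tightened p y x).
Proof.
move=> sp; split; first by exists (p (x + 0 *: y) - 0 * p y), 0 => /=.
by exists (- p (- x)) => _ [s s0 <-]; exact: tightened_lb.
Qed.

Let tighten_le p y x s : sublinear p -> 0 <= s ->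
  tighten p y x <= p (x + s *: y) - s * p y.
Proof.
by move=> sp s0; apply: ge_inf; [exact: (tighten_has_inf y x sp).2|exists s].
Qed.

Let tighten_lb p y x a : sublinear p ->
  (forall s, 0 <= s -> a <= p (x + s *: y) - s * p y) -> a <= tighten p y x.
Proof.
move=> sp h; apply: lb_le_inf; first exact: (tighten_has_inf y x sp).1.
by move=> _ [s s0 <-]; exact: h.
Qed.

Let tighten_lep p y x : sublinear p -> tighten p y x <= p x.
Proof.
by move=> sp; have := tighten_le y x sp (lexx 0); rewrite scale0r mul0r addr0 subr0.
Qed.

Let tightenN p y : sublinear p -> tighten p y (- y) <= - p y.
Proof.
move=> sp; have := tighten_le y (- y) sp ler01.
by rewrite scale1r mul1r addNr sublinear0// add0r.
Qed.

Let tighten_sublinear p y : sublinear p -> sublinear (tighten p y).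
Proof.
move=> sp; split=> [x x'|k x k0].
- rewrite -lerBlDr; apply: tighten_lb => // s s0.
  rewrite lerBlDr -lerBlDl; apply: tighten_lb => // s' s'0.
  rewrite lerBlDr; apply: (le_trans (tighten_le y _ sp (addr_ge0 s0 s'0))).
  rewrite scalerDl addrACA; have := sp.1 (x + s *: y) (x' + s' *: y); lra.
- rewrite -ler_pdivrMl//; apply: tighten_lb => // s s0; rewrite ler_pdivrMl//.
  apply: (le_trans (tighten_le y _ sp (mulr_ge0 (ltW k0) s0))).
  by rewrite -scalerA -scalerDr sublinearZ// mulrBr mulrA.
Qed.

(** Subadditivity of the infimum needs one member serving both arguments; totality of the chain lets
    the smaller of two members do so. The bound [- p (- x)] keeps the infimum finite. *)
Let chain_inf p (F : set (V -> R)) : F !=set0 ->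
  (forall q, F q -> sublinear q /\ forall x, q x <= p x) ->
  (forall q r, F q -> F r -> (forall x, q x <= r x) \/ (forall x, r x <= q x)) ->
  sublinear p ->
  let q0 x := inf [set q x | q in F] in
  sublinear q0 /\ forall q, F q -> forall x, q0 x <= q x.
Proof.
move=> [q1 Fq1] Fp Ftot sp q0.
have hi x : has_inf [set q x | q in F].
  split; first by exists (q1 x), q1.
  exists (- p (- x)) => _ [q Fq <-]; have [sq qp] := Fp _ Fq.
  by apply: le_trans (sublinearN x sq); rewrite lerN2.
have q0le q x : F q -> q0 x <= q x.
  by move=> Fq; apply: ge_inf; [exact: (hi x).2|exists q].
have q0lb x a : (forall q, F q -> a <= q x) -> a <= q0 x.
  by move=> h; apply: lb_le_inf; [exact: (hi x).1|move=> _ [q Fq <-]; exact: h].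
split=> [|q Fq x]; last exact: q0le.
split=> [x y|k x k0].
- rewrite -lerBlDr; apply: (q0lb _ _) => // q Fq.
  rewrite lerBlDr -lerBlDl; apply: (q0lb _ _) => // r Fr; rewrite lerBlDr.
  have [qr|rq] := Ftot _ _ Fq Fr.
    apply: (le_trans (q0le _ _ Fq)); have [sq _] := Fp _ Fq.
    by have := sq.1 x y; have := qr y; lra.
  apply: (le_trans (q0le _ _ Fr)); have [sr _] := Fp _ Fr.
  by have := sr.1 x y; have := rq x; lra.
- rewrite -ler_pdivrMl//; apply: (q0lb _ _) => // q Fq; rewrite ler_pdivrMl//.
  by apply: (le_trans (q0le _ _ Fq)); exact: (Fp _ Fq).1.2.
Qed.

(* A minimal sublinear functional [q] is linear: it equals its own tightening
   along any [y], whence [q (- y) <= - q y]. *)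
Theorem hahn_banach p d : sublinear p -> exists l : V -> R,
  [/\ forall x y, l (x + y) = l x + l y, forall k x, l (k *: x) = k * l x,
      forall x, l x <= p x & l d = p d].
Proof.
(* Minimising below [tighten p d] rather than below [p] forces the value at [- d] to be at most
   [- p d], whence [l d = p d]. *)
move=> sp; pose p1 := tighten p d.
have sp1 : sublinear p1 := tighten_sublinear d sp.
pose Q := {q : V -> R | sublinear q /\ forall x, q x <= p1 x}.
(* The order is reversed: a maximal element for [ord] is a minimal functional. *)
pose ord (q r : Q) := `[< forall x, sval r x <= sval q x >].
have [||||[q [sq qp1]] qmin] := @Zorn Q ord.
- by move=> q; apply/asboolP.
- move=> q r s /asboolP qr /asboolP rs; apply/asboolP => x.
  exact: le_trans (rs x) (qr x).
- move=> [q hq] [r hr] /asboolP/= qr /asboolP/= rq; apply: eq_exist.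
  by apply/funext => x; apply/eqP; rewrite eq_le qr rq.
- move=> F Ftot; have [F0|/set0P[q1 Fq1]] := eqVneq F set0.
    have h : sublinear p1 /\ forall x, p1 x <= p1 x by [].
    by exists (exist _ p1 h) => s; rewrite F0.
  have [||||sq0 q0F] := @chain_inf p1 [set sval q | q in F].
  + by exists (sval q1), q1.
  + by move=> _ [[q hq] Fq <-].
  + move=> _ _ [q Fq <-] [r Fr <-].
    by have [/asboolP h|/asboolP h] := Ftot _ _ Fq Fr; [right|left].
  + exact: sp1.
  have h : sublinear (fun x => inf [set q x | q in [set sval q | q in F]]) /\
      forall x, inf [set q x | q in [set sval q | q in F]] <= p1 x.
    split=> // x; apply: (le_trans (q0F (sval q1) _ x)); first by exists q1.
    exact: (proj2 (svalP q1)).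
  exists (exist _ (fun x => inf [set q x | q in [set sval q | q in F]]) h) => s Fs.
  by apply/asboolP => x /=; apply: q0F; exists s.
have qN y : q (- y) = - q y.
  have h : sublinear (tighten q y) /\ forall x, tighten q y x <= p1 x.
    split; first exact: tighten_sublinear.
    by move=> x; apply: le_trans (qp1 x); exact: tighten_lep.
  have hq : ord (exist _ q (conj sq qp1)) (exist _ (tighten q y) h).
    by apply/asboolP => x /=; exact: tighten_lep.
  have E : tighten q y = q := congr1 (fun r : Q => sval r) (qmin _ hq).
  have := tightenN y sq; rewrite E => le1.
  by have := sublinearN y sq => le2; apply/eqP; rewrite eq_le le1/=; lra.
have qD x y : q (x + y) = q x + q y.
  apply/eqP; rewrite eq_le sq.1/=.
  by have := sq.1 (x + y) (- y); rewrite addrK qN; lra.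
exists q; split=> //.
- move=> k x; have [k0|k0|->] := ltgtP k 0.
  + have kN : 0 < - k by rewrite oppr_gt0.
    by have := sublinearZ x sq kN; rewrite scaleNr qN; lra.
  + by rewrite sublinearZ.
  + by rewrite scale0r mul0r sublinear0.
- by move=> x; apply: le_trans (qp1 x) _; exact: tighten_lep.
- apply/eqP; rewrite eq_le; apply/andP; split.
    by apply: le_trans (qp1 d) _; exact: tighten_lep.
  have := qp1 (- d); have := tightenN d sp; rewrite qN -/p1 /p1; lra.
Qed.

End HahnBanach.

Section DualSpace.
Context {R : realType} {V : normedModType R}.

Lemma bounded_opI {W : normedModType R} (l : V -> W) (C : R) :
  (forall x y, l (x + y) = l x + l y) -> (forall k x, l (k *: x) = k *: l x) ->
  (forall x, `|l x| <= C * `|x|) -> exists f : bounded_op V W, forall x, f x = l x.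
Proof.
move=> lD lZ lC.
have ll : linear l by move=> k x y; rewrite lD lZ.
suff h : l \in @bounded_linear_pred R V W by exists (BoundedOp h).
apply/asboolP; split=> //.
pose L : {linear V -> W} := HB.pack l (GRing.isLinear.Build _ _ _ _ l ll).
apply: (@bounded_linear_continuous _ _ _ L).
apply/linear_boundedP; near=> r => x; apply: (le_trans (lC x)).
by rewrite ler_wpM2r//; near: r; exact: nbhs_pinfty_ge.
Unshelve. all: by end_near. Qed.


Lemma hahn_banach_dual (p : V -> R) (d : V) (C : R) : sublinear p ->
  (forall x, p x <= C * `|x|) ->
  exists l : dual R V, (forall x, <| l, x |> <= p x) /\ <| l, d |> = p d.
Proof.
move=> sp pC; have [l [lD lZ lp ld]] := hahn_banach d sp.
have [f fl] : exists f : dual R V, forall x, f x = l x.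
  apply: (@bounded_opI R^o _ C) => // x.
  have lN : l (- x) = - l x by rewrite -scaleN1r lZ mulN1r.
  rewrite ler_norml; apply/andP; split; last exact: le_trans (lp x) (pC x).
  rewrite lerNl -lN; apply: le_trans (lp (- x)) _.
  by rewrite -[`|x|]normrN; exact: pC.
by exists f; split=> [x|]; rewrite /pairing fl.
Qed.

End DualSpace.

(** * Clarke derivatives *)

Section ClarkeTheory.
Context {R : realType} {X : normedModType R}.
Implicit Types (psi : X -> R) (x y v : X).

Lemma locally_lipschitzP psi x : locally_lipschitz psi ->
  exists L r, [/\ 0 <= L, 0 < r & forall y z, `|x - y| < r -> `|x - z| < r ->
    `|psi y - psi z| <= L * `|y - z|].
Proof.
move=> /(_ x)[U /nbhs_ballP[r /= r0 rU] /pinfty_ex_gt0[L L0 lipU]].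
exists L, r; split=> //; first exact: ltW.
move=> y z xy xz; apply: (lipU (y, z)) => /=.
by split; apply: rU; rewrite -ball_normE.
Qed.

Let quot psi v (p : X * R) := ((psi (p.1 + p.2 *: v) - psi p.1) / p.2)%:E.

Let near_prodP (P : X * R -> Prop) x :
  filter_prod (nbhs x) (0 : R)^'+ P <->
  exists2 d, 0 < d & forall y l, `|x - y| < d -> 0 < l -> l < d -> P (y, l).
Proof.
split=> [[[A B] /= [/nbhs_ballP[d /= d0 dA] [e /= e0 eB]] ABP]|[d d0 dP]].
  exists (Num.min d e); first by rewrite lt_min d0.
  move=> y l; rewrite !lt_min => /andP[xy _] l0 /andP[_ le]; apply: ABP.
  split=> /=; first by apply: dA; rewrite -ball_normE.
  by apply: eB => //=; rewrite sub0r normrN gtr0_norm.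
exists ([set y | `|x - y| < d], [set l | 0 < l /\ l < d]) => /=.
  split; first by apply/nbhs_ballP; exists d => //= y; rewrite -ball_normE.
  by exists d => //= l /=; rewrite sub0r normrN => + l0; rewrite gtr0_norm.
by move=> [y l] /= [xy [l0 ld]]; exact: dP.
Qed.

Let lim psi x v := limf_esup (quot psi v) (filter_prod (nbhs x) (0 : R)^'+).

Let lim_lb psi x v a :
  (exists2 d, 0 < d & forall y l, `|x - y| < d -> 0 < l -> l < d ->
    a * l <= psi (y + l *: v) - psi y) -> (a%:E <= lim psi x v)%E.
Proof.
move=> [d d0 h]; apply: le_ereal_inf_tmp => _ [P /near_prodP[e e0 eP] <-].
have de0 : 0 < Num.min d e / 2 by rewrite divr_gt0// lt_min d0.
have [ded dee] : Num.min d e / 2 < d /\ Num.min d e / 2 < e.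
  have : Num.min d e <= d by rewrite ge_min lexx.
  have : Num.min d e <= e by rewrite ge_min lexx orbT.
  move: de0; lra.
apply: le_ereal_sup_tmp.
exists (quot psi v (x, Num.min d e / 2)).
  by exists (x, Num.min d e / 2) => //; apply: eP; rewrite ?subrr ?normr0.
by rewrite lee_fin/= ler_pdivlMr//; apply: h; rewrite ?subrr ?normr0.
Qed.

Let lim_ub psi x v a :
  (exists2 d, 0 < d & forall y l, `|x - y| < d -> 0 < l -> l < d ->
    psi (y + l *: v) - psi y <= a * l) -> (lim psi x v <= a%:E)%E.
Proof.
move=> [d d0 h]; apply: ge_ereal_inf.
exists (ereal_sup (quot psi v @` [set p | [/\ `|x - p.1| < d, 0 < p.2 & p.2 < d]])).
  exists [set p | [/\ `|x - p.1| < d, 0 < p.2 & p.2 < d]] => //.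
  by apply/near_prodP; exists d.
apply: ge_ereal_sup => _ [[y l] /= [xy l0 ld] <-].
by rewrite lee_fin/= ler_pdivrMr//; exact: h.
Qed.

Let increment_bound psi x : locally_lipschitz psi ->
  exists2 L, 0 <= L & forall v, exists2 d, 0 < d & forall y l, `|x - y| < d -> 0 < l -> l < d ->
    `|psi (y + l *: v) - psi y| <= L * `|v| * l.
Proof.
move=> /(@locally_lipschitzP _ x)[L [r [L0 r0 lip]]]; exists L => // v.
have v1 : 0 < 1 + `|v| by rewrite ltr_pwDl.
(* Below this radius [y] and [y + l *: v] both stay within [r] of [x]; the summand 1 covers
   [v = 0]. *)
exists (r / 2 / (1 + `|v|)); first by rewrite !divr_gt0.
have dr : r / 2 / (1 + `|v|) <= r / 2.
  by rewrite ler_pdivrMr// ler_peMr ?lerDl// divr_ge0// ltW.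
move=> y l xy l0 ld.
have ly : l * `|v| <= r / 2.
  have : l * (1 + `|v|) < r / 2 by rewrite -ltr_pdivlMr.
  by rewrite mulrDr mulr1; move: l0; lra.
apply: (le_trans (lip _ _ _ _)).
- rewrite opprD addrA; apply: le_lt_trans (ler_normB _ _) _.
  rewrite normrZ gtr0_norm//; lra.
- lra.
- by rewrite addrAC subrr add0r normrZ gtr0_norm// mulrCA mulrC mulrAC.
Qed.

(** [clarke_deriv] goes through [fine]; finiteness, given by the local Lipschitz constant on both
    sides, is what identifies it with the actual upper limit. *)
Let lim_fin psi x v : locally_lipschitz psi -> lim psi x v \is a fin_num.
Proof.
move=> /(@increment_bound _ x)[L L0 /(_ v)[d d0 h]].
have lb : ((- (L * `|v|))%:E <= lim psi x v)%E.
  apply: lim_lb; exists d => // y l xy l0 ld; have := h _ _ xy l0 ld.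
  by rewrite ler_norml => /andP[+ _]; rewrite mulNr.
have ub : (lim psi x v <= (L * `|v|)%:E)%E.
  apply: lim_ub; exists d => // y l xy l0 ld; have := h _ _ xy l0 ld.
  by rewrite ler_norml => /andP[].
by rewrite fin_numE; apply/andP; split; apply/eqP => E; rewrite E in lb ub.
Qed.

Lemma clarke_deriv_near psi x v e : locally_lipschitz psi -> 0 < e ->
  exists2 d, 0 < d & forall y l, `|x - y| < d -> 0 < l -> l < d ->
    psi (y + l *: v) - psi y <= (clarke_deriv psi x v + e) * l.
Proof.
move=> lip e0; have : (lim psi x v < (clarke_deriv psi x v + e)%:E)%E.
  by rewrite EFinD /clarke_deriv fineK ?lim_fin// lteDl// ?lim_fin.
move=> /ereal_inf_lt[_ [P /near_prodP[d d0 dP] <-] Plt].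
exists d => // y l xy l0 ld; rewrite -ler_pdivrMr// -lee_fin.
apply: le_trans (ltW Plt); apply: ereal_sup_ubound.
by exists (y, l) => //; exact: dP.
Qed.

Lemma clarke_deriv_le psi x v a : locally_lipschitz psi ->
  (exists2 d, 0 < d & forall y l, `|x - y| < d -> 0 < l -> l < d ->
    psi (y + l *: v) - psi y <= a * l) -> clarke_deriv psi x v <= a.
Proof.
by move=> lip h; rewrite -lee_fin /clarke_deriv fineK ?lim_fin//; exact: lim_ub.
Qed.

Lemma clarke_deriv_lip psi x : locally_lipschitz psi ->
  exists2 L, 0 <= L & forall v, clarke_deriv psi x v <= L * `|v|.
Proof.
move=> lip; have [L L0 h] := increment_bound x lip.
exists L => // v; have [d d0 hd] := h v; apply: clarke_deriv_le => //.
by exists d => // y l xy l0 ld; apply: le_trans (ler_norm _) _; exact: hd.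
Qed.

(** For subadditivity the increment along u + v is split at [y + l *: v]: the upper limit also
    varies the base point, so the second piece is again an admissible quotient. Homogeneity is a
    rescaling of [l]. *)
Lemma clarke_deriv_sublinear psi x : locally_lipschitz psi ->
  sublinear (clarke_deriv psi x).
Proof.
move=> lip; split=> [u v|k v k0].
- apply/ler_addgt0Pr => e e0; have e20 : 0 < e / 2 by rewrite divr_gt0.
  have [d1 d10 h1] := clarke_deriv_near x u lip e20.
  have [d2 d20 h2] := clarke_deriv_near x v lip e20.
  have v1 : 0 < 1 + `|v| by rewrite ltr_pwDl.
  apply: clarke_deriv_le => //; exists (Num.min d2 (d1 / 2 / (1 + `|v|))).
    by rewrite lt_min d20 !divr_gt0.
  have dr : d1 / 2 / (1 + `|v|) <= d1 / 2.
    by rewrite ler_pdivrMr// ler_peMr ?lerDl// divr_ge0// ltW.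
  move=> y l; rewrite !lt_min => /andP[xy2 xy1] l0 /andP[l2 l1].
  have ly : l * `|v| <= d1 / 2.
    have : l * (1 + `|v|) < d1 / 2 by rewrite -ltr_pdivlMr.
    by rewrite mulrDr mulr1; move: l0; lra.
  have H2 := h2 y l xy2 l0 l2.
  have := h1 (y + l *: v) l _ l0 (lt_le_trans l1 _).
  rewrite opprD addrA -[y + l *: v + _]addrA -scalerDr [v + u]addrC => H1.
  have {}H1 : psi (y + l *: (u + v)) - psi (y + l *: v) <=
      (clarke_deriv psi x u + e / 2) * l.
    apply: H1; last by lra.
    apply: le_lt_trans (ler_normB _ _) _; rewrite normrZ gtr0_norm//; lra.
  by move: H1 H2; lra.
- rewrite -ler_pdivrMl//; apply/ler_addgt0Pr => e e0.
  have [d d0 h] := clarke_deriv_near x v lip e0.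
  rewrite ler_pdivrMl//; apply: clarke_deriv_le => //.
  exists (Num.min d (d / k)); first by rewrite lt_min d0 divr_gt0.
  move=> y l; rewrite !lt_min => /andP[xy _] l0 /andP[_ ldk].
  have := h y (l * k) xy (mulr_gt0 l0 k0); rewrite -ltr_pdivlMr// => /(_ ldk).
  rewrite scalerA => /le_trans; apply; rewrite le_eqVlt; apply/predU1P; left; ring.
Qed.

(** A quotient bound valid within [d] of [x] is valid within [d / 2] of every [y] closer than
    [d / 2] to [x]. *)
Lemma clarke_deriv_usc psi x v e : locally_lipschitz psi -> 0 < e ->
  exists2 d, 0 < d & forall y, `|x - y| < d ->
    clarke_deriv psi y v <= clarke_deriv psi x v + e.
Proof.
move=> lip e0; have [d d0 h] := clarke_deriv_near x v lip e0.
exists (d / 2); first by rewrite divr_gt0.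
move=> y xy; apply: clarke_deriv_le => //; exists (d / 2); first by rewrite divr_gt0.
move=> z l yz l0 ld; apply: h => //; last by lra.
by apply: le_lt_trans (ler_distD y _ _) _; lra.
Qed.

(** The Clarke derivative is the support function of the subdifferential, and the supremum is
    attained: this is Hahn-Banach for the sublinear function [clarke_deriv psi x]. In particular the
    subdifferential is nonempty. *)
Lemma clarke_deriv_support psi x d : locally_lipschitz psi ->
  exists l : dual R X, clarke_subdiff psi x l /\ <| l, d |> = clarke_deriv psi x d.
Proof.
move=> lip; have [L _ hL] := clarke_deriv_lip x lip.
exact: hahn_banach_dual (clarke_deriv_sublinear x lip) hL.
Qed.

Lemma pairing_le (l : dual R X) x : `|<| l, x |>| <= `|l| * `|x|.
Proof. exact: op_normP. Qed.

Lemma clarke_deriv_le_growth psi x v C : locally_lipschitz psi ->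
  (set_norm (clarke_subdiff psi x) <= C%:E)%E -> clarke_deriv psi x v <= C * `|v|.
Proof.
move=> lip hC; have [l [lx <-]] := clarke_deriv_support x v lip.
apply: le_trans (ler_norm _) _; apply: le_trans (pairing_le _ _) _.
apply: ler_wpM2r => //; rewrite -lee_fin; apply: le_trans hC.
by apply: ereal_sup_ubound; exists l.
Qed.

End ClarkeTheory.

(** * Convexity and weak compactness *)

Definition segment_closed {R : realType} {V : lmodType R} (K : set V) :=
  forall x y s, K x -> K y -> 0 <= s -> s <= 1 -> K (s *: x + (1 - s) *: y).

Section ConvexFunctions.
Context {R : realType} {V : normedModType R}.
Implicit Types (g : V -> R) (K : set V).

Definition convex_on_line g := forall x y s, 0 <= s -> s <= 1 ->
  g (s *: x + (1 - s) *: y) <= s * g x + (1 - s) * g y.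

(** A Clarke subgradient of a convex function is an ordinary one: the quotient at [y] in direction
    [x - w] is at most [g (y + (x - w)) - g y], which is close to [g x - g w] for [y] near [w]. *)
Lemma convex_subgradient g w : convex_on_line g -> locally_lipschitz g ->
  exists l : dual R V, forall x, g w + <| l, x - w |> <= g x.
Proof.
move=> cg lip; have [l [ldg _]] := clarke_deriv_support w 0 lip.
exists l => x; rewrite addrC -lerBrDr; apply: le_trans (ldg _) _.
apply/ler_addgt0Pr => e e0.
have cont z : exists2 d, 0 < d & forall y, `|z - y| < d -> `|g z - g y| < e / 2.
  have [L [r [L0 r0 h]]] := locally_lipschitzP z lip.
  exists (Num.min r (e / 2 / (L + 1))).
    by rewrite lt_min r0 !divr_gt0// ltr_wpDl.
  move=> y; rewrite lt_min => /andP[zr ze].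
  apply: le_lt_trans (h _ _ _ zr) _; first by rewrite subrr normr0.
  move: ze; rewrite ltr_pdivlMr ?ltr_wpDl//; apply: le_lt_trans.
  by rewrite mulrDr mulr1 mulrC lerDl.
have [d1 d10 h1] := cont x; have [d2 d20 h2] := cont w.
apply: clarke_deriv_le => //; exists (Num.min 1 (Num.min d1 d2)).
  by rewrite !lt_min ltr01 d10.
move=> y s; rewrite !lt_min => /andP[_ /andP[y1 y2]] s0 /andP[s1 _].
have := cg (y + (x - w)) y s (ltW s0) (ltW s1).
have -> : s *: (y + (x - w)) + (1 - s) *: y = y + s *: (x - w).
  by rewrite scalerDr scalerBl scale1r addrC addrA subrK.
move=> cgs; have : g (y + (x - w)) - g y <= g x - g w + e.
  have E : x - (y + (x - w)) = w - y.
    by rewrite opprD opprB addrCA (addrC x) subrK addrC.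
  have := h1 (y + (x - w)); rewrite E => /(_ y1); have := h2 y y2.
  by rewrite !ltr_norml => /andP[? ?] /andP[? ?]; lra.
by rewrite -(ler_pM2r s0); lra.
Qed.

Definition dist_set K x := inf [set `|x - k| | k in K].

Lemma dist_set_le K x k : K k -> dist_set K x <= `|x - k|.
Proof. by move=> Kk; apply: ge_inf; [exists 0 => _ [? _ <-]|exists k]. Qed.

Lemma dist_set_lt K x e : K !=set0 -> 0 < e ->
  exists2 k, K k & `|x - k| < dist_set K x + e.
Proof.
move=> [k0 Kk0] e0; have hi : has_inf [set `|x - k| | k in K].
  by split; [exists `|x - k0|, k0|exists 0 => _ [? _ <-]].
by have [_ [k Kk <-] h] := inf_adherent e0 hi; exists k.
Qed.

Lemma dist_set_closed K x : closed K -> K !=set0 -> dist_set K x <= 0 -> K x.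
Proof.
move=> cK K0 d0; apply: cK => B /nbhs_ballP[e /= e0 eB].
have [k Kk xk] := dist_set_lt x K0 e0; exists k; split=> //.
by apply: eB; rewrite -ball_normE/=; lra.
Qed.

Lemma dist_set_lip K x y : K !=set0 -> dist_set K x - dist_set K y <= `|x - y|.
Proof.
move=> K0; apply/ler_addgt0Pr => e e0; have [k Kk yk] := dist_set_lt y K0 e0.
have := dist_set_le x Kk; have := ler_distD y x k; lra.
Qed.

Lemma locally_lipschitzW g (L : R) :
  (forall x y, g x - g y <= L * `|x - y|) -> locally_lipschitz g.
Proof.
move=> h x; exists setT; first exact: filterT.
exists L; split; first exact: num_real.
move=> M LM [y z] _ /=; apply: (@le_trans _ _ (L * `|y - z|)).
  by rewrite ler_norml h andbT lerNl opprB distrC h.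
by rewrite ler_wpM2r// ltW.
Qed.

Lemma convex_dist_set K : segment_closed K -> K !=set0 ->
  convex_on_line (dist_set K).
Proof.
move=> cK K0 x y s s0 s1; apply/ler_addgt0Pr => e e0.
have [k Kk xk] := dist_set_lt x K0 e0; have [l Kl yl] := dist_set_lt y K0 e0.
apply: le_trans (dist_set_le _ (cK _ _ _ Kk Kl s0 s1)) _.
have -> : s *: x + (1 - s) *: y - (s *: k + (1 - s) *: l) =
    s *: (x - k) + (1 - s) *: (y - l).
  by rewrite opprD addrACA -!scalerBr.
apply: le_trans (ler_normD _ _) _; rewrite !normrZ !ger0_norm ?subr_ge0//.
have : s * `|x - k| <= s * (dist_set K x + e) by rewrite ler_wpM2l// ltW.
have : (1 - s) * `|y - l| <= (1 - s) * (dist_set K y + e).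
  by rewrite ler_wpM2l ?subr_ge0// ltW.
lra.
Qed.

End ConvexFunctions.

(** * Weak limits along ultrafilters *)

Section WeakCompactness.
Context {R : realType}.

Lemma proper_meet {I} (F : set_system I) (A B : set I) : ProperFilter F ->
  F A -> F B -> exists i, A i /\ B i.
Proof. by move=> FF FA FB; apply: (@filter_ex _ F); exact: filterI. Qed.

(** A filter is the intersection of the ultrafilters refining it: otherwise adding the complement of
    the set leaves a proper filter, and an ultrafilter above that one gives a contradiction. *)
Lemma ultra_cvgP {I T} (F : set_system I) (g : I -> T) (P : set T) :
  ProperFilter F ->
  (forall U, UltraFilter U -> F `<=` U -> U (g @^-1` P)) -> F (g @^-1` P).
Proof.
move=> FF h; apply: contrapT => nFP.
have PG : ProperFilter (within (~` (g @^-1` P)) F).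
  apply: Build_ProperFilter_ex => B FB; apply: contrapT => B0.
  have {}FB : F [set i | (~` (g @^-1` P)) i -> B i] := FB.
  apply: nFP; apply: filterS FB => i /= iB; apply: contrapT => nP; apply: B0.
  by exists i; exact: iB.
have [U [UU GU]] := ultraFilterLemma PG.
have UP : U (g @^-1` P).
  by apply: h => // A FA; apply: GU; apply: filterS FA => i Ai _.
have UnP : U (~` (g @^-1` P)) by apply: GU; exact: withinT.
by have [i []] := proper_meet _ UP UnP.
Qed.

Lemma ultra_bounded_cvg {I} (U : set_system I) (u : I -> R) (C : R) :
  UltraFilter U -> U [set i | `|u i| <= C] ->
  exists2 l, `|l| <= C & forall e, 0 < e -> U [set i | `|u i - l| < e].
Proof.
move=> UU UC.
have UC' : U [set i | u i \in `[- C, C]].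
  by apply: filterS UC => i /=; rewrite in_itv/= ler_norml.
have [l [/= lC ul]] :=
  @segment_compact R (- C) C (u @ U) (fmap_proper_filter u ultra_proper) UC'.
exists l; first by move: lC; rewrite in_itv/= ler_norml.
move=> e e0; have [//|nUe] := in_ultra_setVsetC [set i | `|u i - l| < e] UU.
have [] := ul (~` [set y | `|y - l| < e]) (ball l e).
- exact: nUe.
- exact: nbhsx_ballx.
by move=> y [/= + ly]; rewrite distrC; rewrite -ball_normE /= in ly.
Qed.

Context {V : normedModType R} (V_refl : reflexive_space V).

(* The ultralimit of evaluations is a bounded functional on the dual, hence by
   reflexivity an evaluation. *)
Lemma ultra_weak_limit {I} (U : set_system I) (x : I -> V) (C : R) :
  UltraFilter U -> U [set i | `|x i| <= C] ->
  exists w, forall (f : dual R V) e, 0 < e ->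
    U [set i | `|<| f, x i |> - <| f, w |>| < e].
Proof.
move=> UU UC; have C0 : 0 <= C.
  by have /filter_ex[i /=] := UC; exact: le_trans.
have lim_ex (f : dual R V) : exists l, `|l| <= `|f| * C /\
    forall e, 0 < e -> U [set i | `|<| f, x i |> - l| < e].
  have [|l] := @ultra_bounded_cvg _ U (fun i => <| f, x i |>) (`|f| * C) UU.
    apply: filterS UC => i /= xC; apply: le_trans (pairing_le _ _) _.
    by rewrite ler_wpM2l.
  by exists l.
have [F FP] := choice lim_ex.
have F_uniq f l : (forall e, 0 < e -> U [set i | `|<| f, x i |> - l| < e]) -> F f = l.
  move=> h; apply/eqP; rewrite -subr_eq0 -normr_le0; apply/ler_addgt0Pr => e e0.
  have e2 : 0 < e / 2 by rewrite divr_gt0.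
  have [i [/= h1 h2]] := proper_meet _ ((FP f).2 _ e2) (h _ e2).
  have := ler_distD <| f, x i |> (F f) l; rewrite (distrC (F f) <| f, x i |>); lra.
have FD f g : F (f + g) = F f + F g.
  apply: F_uniq => e e0; have e2 : 0 < e / 2 by rewrite divr_gt0.
  apply: filterS (filterI ((FP f).2 _ e2) ((FP g).2 _ e2)) => i [/= h1 h2].
  have -> : <| f + g, x i |> - (F f + F g) = (<| f, x i |> - F f) + (<| g, x i |> - F g).
    by rewrite addrACA opprD.
  apply: le_lt_trans (ler_normD _ _) _; lra.
have FZ k f : F (k *: f) = k * F f.
  apply: F_uniq => e e0; have k0 : 0 < `|k| + 1 by rewrite ltr_wpDl.
  have ek : 0 < e / (`|k| + 1) by rewrite divr_gt0.
  apply: filterS ((FP f).2 _ ek) => i /=; rewrite ltr_pdivlMr// => h.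
  have -> : <| k *: f, x i |> - k * F f = k * (<| f, x i |> - F f) by rewrite mulrBr.
  by rewrite normrM; apply: le_lt_trans h; rewrite mulrC ler_wpM2l// lerDl.
have [Phi PhiE] : exists Phi : dual R (dual R V), forall f, Phi f = F f.
  apply: (@bounded_opI _ _ R^o _ C) => // f.
  by rewrite mulrC; exact: (FP f).1.
have [w wP] := V_refl Phi; exists w => f e e0.
by have := (FP f).2 _ e0; rewrite -PhiE wP.
Qed.

(** A subgradient at [w] is an affine minorant of [g], exact at [w], and affine functions pass to
    weak limits. *)
Lemma convex_ultra_limit {I} (U : set_system I) (x : I -> V) w g c :
  UltraFilter U -> convex_on_line g -> locally_lipschitz g ->
  (forall (f : dual R V) e, 0 < e -> U [set i | `|<| f, x i |> - <| f, w |>| < e]) ->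
  U [set i | g (x i) <= c] -> g w <= c.
Proof.
move=> UU cg lip xw Uc; have [l lP] := convex_subgradient w cg lip.
apply/ler_addgt0Pr => e e0.
have [i [/= gc]] := proper_meet _ Uc (xw l e e0).
rewrite ltr_norml => /andP[h _]; have := lP (x i).
have -> : <| l, x i - w |> = <| l, x i |> - <| l, w |> by exact: linearB.
lra.
Qed.

(** The distance to [K] is convex and Lipschitz, so the previous lemma applies to it; its zeros lie
    in [K] because [K] is closed. *)
Lemma closed_convex_ultra_limit {I} (U : set_system I) (x : I -> V) w K :
  UltraFilter U -> segment_closed K -> closed K -> K !=set0 ->
  (forall (f : dual R V) e, 0 < e -> U [set i | `|<| f, x i |> - <| f, w |>| < e]) ->
  U [set i | K (x i)] -> K w.
Proof.
move=> UU sK cK K0 xw UK; apply: dist_set_closed => //.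
apply: (convex_ultra_limit UU (convex_dist_set sK K0) _ xw).
  by apply: (@locally_lipschitzW _ _ _ 1) => y z; rewrite mul1r; exact: dist_set_lip.
apply: filterS UK => i /= Kx; apply: le_trans (dist_set_le _ Kx) _.
by rewrite subrr normr0.
Qed.

End WeakCompactness.

Lemma separable_seq {R : realType} {V : normedModType R} : separable V ->
  exists d : nat -> V, forall x e, 0 < e -> exists k, `|x - d k| < e.
Proof.
move=> [D cD dD].
have D0 : D !=set0.
  by have [x [_ Dx]] := dD setT ltac:(by exists 0) openT; exists x.
have /pfcard_geP[D00|[d]] := cD; first by move: D0 => /set0P; rewrite D00 eqxx.
exists d => x e e0.
have [y []] := dD (ball x e) ltac:(by exists x; exact: ballxx) (ball_open x e).
rewrite -ball_normE /= => xy /(@surj _ _ setT D d)[k _ ky].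
by exists k; rewrite ky.
Qed.

(** * Weak sequential compactness in separable reflexive spaces *)

Section WeakSequentialCompactness.
Context {R : realType} {V : normedModType R}.

(** A sequence can be matched to an ultralimit [w] against countably many functionals only. Norming
    functionals of a dense sequence suffice: they separate points, so every weak ultralimit of the
    selected sequence equals [w], and [ultra_cvgP] turns this into convergence. The selection [s]
    need not increase; [n <= s n] makes it tend to infinity. *)
Lemma weak_subsequence (w_ : nat -> V) (C : R) :
  separable V -> reflexive_space V -> (forall n, `|w_ n| <= C) ->
  exists s : nat -> nat, exists w, (forall n, (n <= s n)%N) /\ weak_cvg (w_ \o s) w.
Proof.
move=> V_sep V_refl wC; have [d dP] := separable_seq V_sep.
have norm_sublinear : sublinear (fun x : V => `|x|).
  by split=> [x y|k x k0]; [exact: ler_normD|rewrite normrZ gtr0_norm].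
have norming k : exists l : dual R V,
    (forall x, <| l, x |> <= `|x|) /\ <| l, d k |> = `|d k|.
  by apply: (hahn_banach_dual (C := 1) _ norm_sublinear) => x; rewrite mul1r.
have [f fP] := choice norming.
(* If all [f k] vanish at [x], then |d k| = f k (d k - x) <= |d k - x|, which is arbitrarily small
   while [d k] approaches [x]. *)
have f_sep x : (forall k, <| f k, x |> = 0) -> x = 0.
  move=> fx; apply/normr0_eq0/eqP; rewrite eq_le normr_ge0 andbT.
  apply/ler_addgt0Pr => e e0; have e2 : 0 < e / 2 by rewrite divr_gt0.
  have [k xk] := dP x _ e2; have := (fP k).1 (d k - x).
  have -> : <| f k, d k - x |> = <| f k, d k |> - <| f k, x |> by exact: linearB.
  rewrite fx (fP k).2 distrC; have := ler_distD (d k) x 0; rewrite !subr0; lra.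
have [U [UU oU]] := @ultraFilterLemma nat \oo _.
have [|w wP] := @ultra_weak_limit _ _ V_refl _ U w_ C UU.
  by apply: filterE => i; exact: wC.
have sel i : exists n, (i <= n)%N /\ forall k, (k <= i)%N ->
    `|<| f k, w_ n |> - <| f k, w |>| < i.+1%:R^-1.
  have Uk m : U [set n | forall k, (k <= m)%N ->
      `|<| f k, w_ n |> - <| f k, w |>| < i.+1%:R^-1].
    elim: m => [|m IH].
      by apply: filterS (wP (f 0%N) i.+1%:R^-1 _) => // n /= h k; rewrite leqn0 => /eqP ->.
    apply: filterS (filterI IH (wP (f m.+1) i.+1%:R^-1 _)) => // n [/= h1 h2] k.
    by rewrite leq_eqVlt => /predU1P[->|/h1].
  have Ui : U [set n | (i <= n)%N] by apply: oU; exists i.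
  by have [n [/= ? ?]] := proper_meet _ Ui (Uk i); exists n.
have [s sP] := choice sel; exists s, w; split=> [n|]; first exact: (sP n).1.
apply/weak_cvgP => g; apply/cvgrPdist_lt => e e0.
apply: (@ultra_cvgP nat nat \oo id [set n | `|g w - g (w_ (s n))| < e]) => W WU oW.
have [|w' w'P] := @ultra_weak_limit _ _ V_refl _ W (w_ \o s) C WU.
  by apply: filterE => i; exact: wC.
have -> : w = w'.
  apply/eqP; rewrite -subr_eq0; apply/eqP/f_sep => k.
  have -> : <| f k, w - w' |> = <| f k, w |> - <| f k, w' |> by exact: linearB.
  apply/normr0_eq0/eqP; rewrite eq_le normr_ge0 andbT.
  apply/ler_addgt0Pr => r r0; have r2 : 0 < r / 2 by rewrite divr_gt0.
  have Wr : W [set n | (k <= n)%N /\ n.+1%:R^-1 < r / 2].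
    apply: oW; have h := near_infty_natSinv_lt (PosNum r2).
    by near=> n; split; near: n; [exact: nbhs_infty_ge|].
  have [n [[/= kn nr] /= h]] := proper_meet _ Wr (w'P (f k) _ r2).
  have := lt_trans ((sP n).2 k kn) nr.
  have := ler_distD <| f k, w_ (s n) |> <| f k, w |> <| f k, w' |>.
  rewrite (distrC <| f k, w |> <| f k, w_ (s n) |>); lra.
by apply: filterS (w'P g e e0) => n /=; rewrite distrC.
Unshelve. all: by end_near. Qed.

End WeakSequentialCompactness.

(** * Equilibrium problems *)

Section Barycenters.
Context {R : realType}.

(** Each step of the induction is a binary combination of a new point with the barycenter of the
    tail. Weights may vanish, so a tail of total weight 0, which has no barycenter, is treated
    apart. *)
Lemma segment_closed_barycenter {L : lmodType R} {I} (K : set L) (s : seq I)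
    (a : I -> R) (x : I -> L) :
  segment_closed K -> (forall i, 0 <= a i) -> (forall i, 0 < a i -> K (x i)) ->
  0 < \sum_(i <- s) a i ->
  K ((\sum_(i <- s) a i)^-1 *: \sum_(i <- s) a i *: x i).
Proof.
move=> cK a0 Kx; elim: s => [|i s IH]; first by rewrite big_nil ltxx.
rewrite !big_cons; set S := \sum_(j <- s) a j; set X := \sum_(j <- s) a j *: x j.
have S0 : 0 <= S by apply: sumr_ge0.
move: S0; rewrite le_eqVlt => /predU1P[S0|S0] aS.
  have X0 : X = 0.
    move/esym: S0; rewrite /S /X; elim: (s) => [|j r IHr]; first by rewrite !big_nil.
    rewrite !big_cons => /eqP; rewrite paddr_eq0 ?sumr_ge0// => /andP[/eqP-> /eqP/IHr->].
    by rewrite scale0r addr0.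
  move: aS; rewrite -S0 addr0 X0 addr0 => ai.
  rewrite scalerA mulVf ?gt_eqF// scale1r; exact: (Kx _ ai).
have KS := IH S0; have [ai|ai] := eqVneq (a i) 0.
  by rewrite ai scale0r !add0r.
have {}ai : 0 < a i by rewrite lt_neqAle eq_sym ai a0.
have -> : (a i + S)^-1 *: (a i *: x i + X) =
    (a i / (a i + S)) *: x i + (1 - a i / (a i + S)) *: (S^-1 *: X).
  have S1 : S != 0 by rewrite gt_eqF.
  have aS1 : a i + S != 0 by rewrite gt_eqF.
  by rewrite scalerDr !scalerA; congr (_ *: _ + _ *: _); field; rewrite ?S1 ?aS1.
apply: cK; [exact: Kx|exact: KS|by rewrite divr_ge0 ?ltW|].
by rewrite ler_pdivrMr// mul1r lerDl ltW.
Qed.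

(** The barycenter lemma applied to the epigraph of [g], a convex subset of the product with the
    reals. *)
Lemma jensen {V : normedModType R} {I} (g : V -> R) (s : seq I)
    (a : I -> R) (x : I -> V) :
  convex_on_line g -> (forall i, 0 <= a i) -> 0 < \sum_(i <- s) a i ->
  (\sum_(i <- s) a i) * g ((\sum_(i <- s) a i)^-1 *: \sum_(i <- s) a i *: x i) <=
  \sum_(i <- s) a i * g (x i).
Proof.
move=> cg a0 S0; pose epi := [set p : V * R^o | g p.1 <= p.2].
have cepi : segment_closed epi.
  move=> [x1 t1] [x2 t2] r /= h1 h2 r0 r1; apply: le_trans (cg _ _ _ r0 r1) _.
  by apply: lerD; rewrite ler_wpM2l// subr_ge0.
have := @segment_closed_barycenter _ I epi s a (fun i => (x i, g (x i))) cepi a0.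
move=> /(_ _ S0) h; have {h} : epi ((\sum_(i <- s) a i)^-1 *:
    (\sum_(i <- s) a i *: x i, \sum_(i <- s) a i * g (x i))).
  have <- : \sum_(i <- s) a i *: ((x i, g (x i)) : V * R^o) =
      (\sum_(i <- s) a i *: x i, \sum_(i <- s) a i * g (x i)).
    by elim: (s) => [|i r IH]; rewrite ?big_nil// !big_cons IH.
  by apply: h => i _; exact: lexx.
by rewrite /epi/= ler_pdivlMl.
Qed.

End Barycenters.

(** * Finite systems of convex constraints by descent *)

Section FiniteIntersection.
Context {R : realType} {V : normedModType R}.
Variables (K : set V) (H : V -> V -> R).
Hypothesis K_convex : segment_closed K.
Hypothesis H_mono : forall v w, H v w + H w v <= 0.
Hypothesis H_convex : forall v, convex_on_line (H v).
Hypothesis H_bounded : forall v (r : R), exists B : R, forall w, `|w| <= r -> `|H v w| <= B.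

Let a v w := Num.max 0 (H v w).
Let Phi (s : seq V) w := \sum_(v <- s) a v w ^+ 2.

Let a_ge0 v w : 0 <= a v w. Proof. by rewrite le_max lexx. Qed.

(** [Phi s] is the squared penalty of the violated constraints. Along the segment from [w] to a
    point c, convexity bounds each violation by t H v c + (1 - t) a v w; squaring puts the weights
    [a v w] in the cross term, which a suitable c makes nonpositive. *)
Let descent (s : seq V) r : (forall v, v \in s -> K v) ->
  (forall v, v \in s -> `|v| <= r) ->
  exists2 B, 0 <= B & forall w t, K w -> `|w| <= r -> 0 <= t -> t <= 1 ->
    exists w', [/\ K w', `|w'| <= r & Phi s w' <= (1 - t) ^+ 2 * Phi s w + t ^+ 2 * B].
Proof.
move=> sK sr; have [b hb] := choice (fun v => H_bounded v r).
exists (\sum_(v <- s) b v ^+ 2); first by apply: sumr_ge0 => v _; exact: sqr_ge0.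
move=> w t Kw wr t0 t1; pose S := \sum_(v <- s) a v w.
have B0 : 0 <= \sum_(v <- s) b v ^+ 2 by apply: sumr_ge0 => v _; exact: sqr_ge0.
have : 0 <= S by apply: sumr_ge0.
rewrite le_eqVlt => /predU1P[S0|S0].
  exists w; split=> //; have -> : Phi s w = 0.
    apply: big1_seq => v /andP[_ vs]; have : \sum_(v <- s) a v w = 0 by [].
    by move/eqP; rewrite psumr_eq0// => /allP/(_ v vs)/eqP ->; rewrite expr0n.
  by rewrite mulr0 add0r mulr_ge0// sqr_ge0.
(* The weights [a v w / S] select the barycenter [c] of [s] towards which [Phi s]
   decreases, because [\sum_v a v w * H v c <= 0] by monotonicity. *)
pose c := S^-1 *: \sum_(v <- s) a v w *: v.
have [Kc cr] : K c /\ `|c| <= r.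
  (* The barycenter lemma asks for membership at every index of positive weight, also outside [s];
     there [w] serves as a default. *)
  pose x v := if v \in s then v else w.
  have -> : c = S^-1 *: \sum_(v <- s) a v w *: x v.
    by congr (_ *: _); apply: eq_big_seq => v vs; rewrite /x vs.
  apply: (@segment_closed_barycenter R V V [set x | K x /\ `|x| <= r] s (a^~ w) x) => //.
    move=> y z q [Ky yr] [Kz zr] q0 q1; split; first exact: K_convex.
    apply: le_trans (ler_normD _ _) _; rewrite !normrZ !ger0_norm ?subr_ge0//.
    have : q * `|y| <= q * r by rewrite ler_wpM2l.
    have : (1 - q) * `|z| <= (1 - q) * r by rewrite ler_wpM2l// subr_ge0.
    lra.
  by move=> v _; rewrite /x; case: ifPn => [vs|_]; split; auto.
have ab : \sum_(v <- s) a v w * H v c <= 0.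
  rewrite -(pmulr_rle0 _ S0) mulr_sumr.
  apply: (@le_trans _ _ (\sum_(v <- s) \sum_(u <- s) a v w * a u w * H v u)).
    apply: ler_sum => v _; rewrite mulrCA; under eq_bigr do rewrite -mulrA.
    rewrite -mulr_sumr; apply: ler_wpM2l => //.
    exact: (jensen id (@H_convex v)).
  (* The weights [a v w * a u w] are symmetric, so adding the sum with [u] and [v] exchanged pairs
     [H v u] with [H u v]. *)
  set D := (X in X <= 0); suff : D + D <= 0 by lra.
  rewrite {2}/D exchange_big -big_split/=; apply: sumr_le0 => v _.
  rewrite -big_split/=; apply: sumr_le0 => u _.
  by rewrite [a u w * _]mulrC -mulrDr mulr_ge0_le0// mulr_ge0.
clearbody c; exists (t *: c + (1 - t) *: w); split; first exact: K_convex.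
  apply: le_trans (ler_normD _ _) _; rewrite !normrZ !ger0_norm ?subr_ge0//.
  have : t * `|c| <= t * r by rewrite ler_wpM2l.
  have : (1 - t) * `|w| <= (1 - t) * r by rewrite ler_wpM2l// subr_ge0.
  lra.
have -> : (1 - t) ^+ 2 * Phi s w + t ^+ 2 * \sum_(v <- s) b v ^+ 2 =
    \sum_(v <- s) ((1 - t) ^+ 2 * a v w ^+ 2 + t ^+ 2 * b v ^+ 2).
  by rewrite big_split/= -!mulr_sumr.
apply: (@le_trans _ _ (\sum_(v <- s) ((1 - t) ^+ 2 * a v w ^+ 2 + t ^+ 2 * b v ^+ 2)
    + 2 * t * (1 - t) * \sum_(v <- s) a v w * H v c)); last first.
  by rewrite gerDl mulr_ge0_le0// !mulr_ge0// subr_ge0.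
rewrite mulr_sumr -big_split/=; apply: ler_sum => v _.
have hc : H v c ^+ 2 <= b v ^+ 2.
  by rewrite -real_normK ?num_real// lerXn2r ?nnegrE ?hb// (le_trans _ (hb _ _ cr)).
have := H_convex v c w t0 t1; have : H v w <= a v w by rewrite le_max lexx orbT.
set y := H v (_ + _) => Hw Hy.
have {}Hy : y <= t * H v c + (1 - t) * a v w.
  by apply: le_trans Hy _; rewrite lerD2l ler_wpM2l// subr_ge0.
have ay : a v (t *: c + (1 - t) *: w) ^+ 2 <= (t * H v c + (1 - t) * a v w) ^+ 2.
  rewrite /a -/y; case: (leP 0 y) => y0; last by rewrite expr0n sqr_ge0.
  by rewrite lerXn2r ?nnegrE// (le_trans y0).
apply: le_trans ay _.
have : t ^+ 2 * H v c ^+ 2 <= t ^+ 2 * b v ^+ 2 by rewrite ler_wpM2l// sqr_ge0.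
lra.
Qed.

Lemma monotone_finite_intersection (s : seq V) e : K !=set0 ->
  (forall v, v \in s -> K v) -> 0 < e ->
  exists2 w, K w & forall v, v \in s -> H v w <= e.
Proof.
move=> [v0 Kv0] sK e0.
pose r := \sum_(v <- v0 :: s) `|v|.
have sr v : v \in v0 :: s -> `|v| <= r.
  by move=> vs; rewrite /r (big_rem v)//= lerDl sumr_ge0.
have sr' v : v \in s -> `|v| <= r by move=> vs; apply: sr; rewrite inE vs orbT.
have [B B0 hB] := descent sK sr'.
pose A := [set Phi s w | w in [set w | K w /\ `|w| <= r]].
have A0 : has_inf A.
  split; first by exists (Phi s v0), v0 => //; split=> //; apply: sr; rewrite mem_head.
  by exists 0 => _ [w _ <-]; apply: sumr_ge0 => v _; exact: sqr_ge0.
have infA0 : 0 <= inf A.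
  apply: lb_le_inf; first exact: A0.1.
  by move=> _ [w _ <-]; apply: sumr_ge0 => v _; exact: sqr_ge0.
(* Descent from near-minimizers gives inf A <= (1 - t)^2 inf A + t^2 B, that is (2 - t) inf A <= t
   B. Letting t tend to 0 yields inf A = 0. *)
have infA t : 0 < t -> t <= 1 -> inf A <= t * B.
  move=> t0 t1; have : inf A <= (1 - t) ^+ 2 * inf A + t ^+ 2 * B.
    apply/ler_addgt0Pr => d d0.
    have [_ [w [Kw wr] <-] wd] := inf_adherent d0 A0.
    have [w' [Kw' wr' h]] := hB w t Kw wr (ltW t0) t1.
    have : inf A <= Phi s w' by apply: ge_inf; [exact: A0.2|exists w'].
    move=> /le_trans; apply; apply: le_trans h _.
    have : (1 - t) ^+ 2 * Phi s w <= (1 - t) ^+ 2 * (inf A + d).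
      by rewrite ler_wpM2l ?sqr_ge0// ltW.
    have : (1 - t) ^+ 2 * d <= d.
      by rewrite ler_piMl ?(ltW d0)// expr_le1// ?subr_ge0//; lra.
    lra.
  move=> h; have {}h : t * (inf A * (2 - t)) <= t * (t * B) by lra.
  move: h; rewrite ler_pM2l// => /(le_trans _); apply.
  by rewrite ler_peMr//; lra.
have [_ [w [Kw wr] <-]] := inf_adherent (exprn_gt0 2 e0) A0.
have -> : inf A = 0.
  apply/eqP; rewrite eq_le infA0 andbT; apply/ler_addgt0Pr => d d0; rewrite add0r.
  (* This value of t is at most 1 and makes t B at most [d], also when [B] is 0. *)
  have dB : 0 < d / (d + B) by rewrite divr_gt0// ltr_pwDl.
  apply: le_trans (infA _ dB _) _.
    by rewrite ler_pdivrMr ?mul1r ?lerDl// ltr_pwDl.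
  by rewrite mulrAC ler_pdivrMr ?ltr_pwDl// ler_wpM2l ?(ltW d0)// lerDr ltW.
rewrite add0r => we; exists w => // v vs.
have : a v w ^+ 2 < e ^+ 2.
  apply: le_lt_trans we; rewrite /Phi (big_rem v)//= lerDl sumr_ge0// => u _.
  exact: sqr_ge0.
rewrite ltr_pXn2r ?nnegrE ?(ltW e0)// => h.
by apply: le_trans (ltW h); rewrite le_max lexx orbT.
Qed.

End FiniteIntersection.

(** * Minty's argument for strongly monotone bifunctions *)

Section StronglyMonotoneEquilibrium.
Context {R : realType} {V : normedModType R} (V_refl : reflexive_space V).
Variables (K : set V) (G : V -> V -> R) (m : R).
Hypothesis K_closed : closed K.
Hypothesis K_convex : segment_closed K.
Hypothesis K_neq0 : K !=set0.
Hypothesis m_gt0 : 0 < m.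
Hypothesis G_diag : forall v, G v v = 0.
Hypothesis G_mono : forall v w, G v w + G w v <= - (m * `|v - w| ^+ 2).
Hypothesis G_convex : forall v, convex_on_line (G v).
Hypothesis G_lip : forall v, exists L : R, forall x y, G v x - G v y <= L * `|x - y|.
Hypothesis G_hemi : forall w v e, 0 < e ->
  exists s, [/\ 0 < s, s <= 1 & G (s *: v + (1 - s) *: w) v <= G w v + e].

(** The term m / 2 |w - v|^2 can be added in both orders without losing monotonicity. It makes the
    constraint [H v0 w <= 1] coercive, which bounds the approximate solutions. *)
Let H v w := G v w + m / 2 * `|w - v| ^+ 2.

Let H_mono v w : H v w + H w v <= 0.
Proof. by rewrite /H (distrC w v); have := G_mono v w; lra. Qed.

Let H_convex v : convex_on_line (H v).
Proof.
move=> x y s s0 s1; rewrite /H.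
have -> : s *: x + (1 - s) *: y - v = s *: (x - v) + (1 - s) *: (y - v).
  rewrite !scalerBr addrACA -opprD -scalerDl.
  by rewrite addrCA subrr addr0 scale1r.
have s'0 : 0 <= 1 - s by rewrite subr_ge0.
have hn : `|s *: (x - v) + (1 - s) *: (y - v)| <= s * `|x - v| + (1 - s) * `|y - v|.
  by apply: le_trans (ler_normD _ _) _; rewrite !normrZ !ger0_norm.
have : `|s *: (x - v) + (1 - s) *: (y - v)| ^+ 2 <=
    s * `|x - v| ^+ 2 + (1 - s) * `|y - v| ^+ 2.
  apply: (@le_trans _ _ ((s * `|x - v| + (1 - s) * `|y - v|) ^+ 2)).
    by rewrite lerXn2r ?nnegrE// addr_ge0 ?mulr_ge0.
  have : 0 <= s * (1 - s) * (`|x - v| - `|y - v|) ^+ 2.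
    exact: mulr_ge0 (mulr_ge0 s0 s'0) (sqr_ge0 _).
  lra.
have := G_convex v x y s0 s1.
set N := `|_ + _|; set Gs := G v _ => hG hN.
have : m / 2 * N ^+ 2 <= m / 2 * (s * `|x - v| ^+ 2 + (1 - s) * `|y - v| ^+ 2).
  by rewrite ler_wpM2l// divr_ge0// ltW.
lra.
Qed.

Let H_bounded v (r : R) : exists B : R, forall w, `|w| <= r -> `|H v w| <= B.
Proof.
have [L hL] := G_lip v; exists (`|L| * (r + `|v|) + m / 2 * (r + `|v|) ^+ 2) => w wr.
have d : `|w - v| <= r + `|v| by apply: le_trans (ler_normB _ _) _; rewrite lerD2r.
have Ld : L * `|w - v| <= `|L| * (r + `|v|).
  by apply: (@le_trans _ _ (`|L| * `|w - v|)); rewrite ?ler_wpM2r ?ler_norm// ler_wpM2l.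
apply: le_trans (ler_normD _ _) _; apply: lerD.
  rewrite ler_norml; have := hL w v; have := hL v w; rewrite G_diag (distrC v w).
  by move=> ? ?; apply/andP; split; lra.
rewrite ger0_norm; last by rewrite mulr_ge0 ?sqr_ge0// divr_ge0// ltW.
rewrite ler_wpM2l ?divr_ge0 ?(ltW m_gt0)// lerXn2r ?nnegrE//.
by apply: le_trans d.
Qed.

(* Minty: first [G v w <= 0] for all [v], from the finite intersection property
   and weak compactness, then [0 <= G w v] by hemicontinuity. *)
Theorem equilibrium_exists : exists2 w, K w & forall v, K v -> 0 <= G w v.
Proof.
pose D := [set p : seq V * R | (forall v, v \in p.1 -> K v) /\ 0 < p.2].
pose C (p : seq V * R) := [set w | K w /\ forall v, v \in p.1 -> H v w <= p.2].
have PF : ProperFilter (filter_from D C).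
  apply: filter_from_proper; last first.
    move=> [s e] [sK e0].
    have [w Kw h] := monotone_finite_intersection K_convex H_mono H_convex H_bounded
      K_neq0 sK e0.
    by exists w.
  apply: filter_from_filter; first by exists ([::], 1); split=> //=.
  move=> [s e] [t d] [/= sK e0] [/= tK d0]; exists (s ++ t, Num.min e d).
    by split=> /=; [move=> v; rewrite mem_cat => /orP[]; auto|rewrite lt_min e0].
  move=> w [Kw h]; split; split=> // v /= vs.
    by apply: le_trans (h v _) _ => /=; rewrite ?mem_cat ?vs// ge_min lexx.
  by apply: le_trans (h v _) _ => /=; rewrite ?mem_cat ?vs ?orbT// ge_min lexx orbT.
have [U [UU CU]] := ultraFilterLemma PF.
have UH v e : K v -> 0 < e -> U [set w | K w /\ H v w <= e].
  move=> Kv e0; apply: CU; exists ([:: v], e) => /=.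
    by split=> //= u; rewrite inE => /eqP ->.
  by move=> w [Kw h]; split=> //; apply: h; rewrite inE.
have [v0 Kv0] := K_neq0; have [L hL] := G_lip v0.
(* With d = |w - v0|, the constraint [H v0 w <= 1] and the Lipschitz bound give m / 2 d^2 <= 1 + |L|
   d; either d <= 1, or the right side is below (|L| + 1) d. *)
have [|w wP] := @ultra_weak_limit _ _ V_refl _ U id (`|v0| + (1 + 2 * (`|L| + 1) / m)) UU.
  apply: filterS (UH v0 1 Kv0 ltr01) => w [_ h] /=.
  suff : `|w - v0| <= 1 + 2 * (`|L| + 1) / m.
    by have := ler_distD v0 w 0; rewrite !subr0; lra.
  have m20 : 0 <= 2 * (`|L| + 1) / m by rewrite !mulr_ge0// ?invr_ge0 ?(ltW m_gt0)// addr_ge0.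
  have [|d1] := leP `|w - v0| 1; first by lra.
  suff : `|w - v0| <= 2 * (`|L| + 1) / m by lra.
  rewrite ler_pdivlMr//; have := hL v0 w; rewrite G_diag (distrC v0) => hG.
  have Ld : L * `|w - v0| <= `|L| * `|w - v0| by rewrite ler_wpM2r// ler_norm.
  rewrite -(ler_pM2r (lt_trans ltr01 d1)); move: h; rewrite /H; lra.
have Kw : K w.
  apply: (closed_convex_ultra_limit UU K_convex K_closed K_neq0 wP).
  by apply: filterS (UH v0 1 Kv0 ltr01) => v [].
have minty v : K v -> G v w <= 0.
  move=> Kv; apply/ler_addgt0Pr => e e0; rewrite add0r.
  apply: (convex_ultra_limit UU (G_convex v) _ wP).
    by have [M hM] := G_lip v; exact: locally_lipschitzW hM.
  apply: filterS (UH v e Kv e0) => u [_]; apply: le_trans.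
  by rewrite lerDl mulr_ge0 ?sqr_ge0// divr_ge0// ltW.
exists w => // v Kv; apply/ler_addgt0Pr => e e0.
(* Convexity bounds [G vs vs = 0] by s G vs v + (1 - s) G vs w, whose second term is nonpositive by
   [minty]; hence [0 <= G vs v]. *)
have [s [s0 s1 hs]] := G_hemi w v e0; apply: le_trans hs.
have Kvs := K_convex Kv Kw (ltW s0) s1; set vs := _ + _ in Kvs *.
have := G_convex vs v w (ltW s0) s1; rewrite -/vs G_diag.
have : (1 - s) * G vs w <= 0 by rewrite mulr_ge0_le0 ?subr_ge0// minty.
move=> h1 h2; have : 0 <= s * G vs v by lra.
by rewrite pmulr_rge0.
Qed.

End StronglyMonotoneEquilibrium.

(** * The inequality at a fixed time *)

Section SequenceLemmas.
Context {R : realType}.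

Lemma limn_esup_near (u : nat -> R) c e :
  (limn_esup (fun n => (u n)%:E) <= c%:E)%E -> 0 < e ->
  \forall n \near \oo, u n <= c + e.
Proof.
move=> uc e0.
have : (limn_esup (fun n => (u n)%:E) < (c + e)%:E)%E.
  by apply: le_lt_trans uc _; rewrite lte_fin ltrDl.
move=> /ereal_inf_lt[_ [B oB <-] Blt]; apply: filterS oB => n Bn.
by rewrite -lee_fin; apply: le_trans (ltW Blt); apply: ereal_sup_ubound; exists n.
Qed.

Lemma within_continuous_seq {S W : topologicalType} (D : set S) (g : S -> W)
    (x_ : nat -> S) x :
  {within D, continuous g} -> (forall n, D (x_ n)) -> D x ->
  x_ @ \oo --> x -> g \o x_ @ \oo --> g x.
Proof.
move=> cg Dx_ Dx xx; have := cg x; rewrite /continuous_at /= => gx.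
apply: (@cvg_comp _ _ _ (x_ : nat -> subspace D) g _ (nbhs (x : subspace D))) => //.
move=> B nB; have wB : within D (nbhs x) B by rewrite (nbhs_subspace_in Dx).
have h : \forall n \near \oo, D (x_ n) -> B (x_ n) := xx _ wB.
by apply: (filterS _ h) => n; apply; exact: Dx_.
Qed.

Lemma cvg_norm_bounded {W : normedModType R} (u : nat -> W) (l : W) :
  u @ \oo --> l -> exists B : R, forall n, `|u n| <= B.
Proof.
move=> ul; have /cvg_seq_bounded/pinfty_ex_gt0[B B0 hB] : cvgn u by apply/cvg_ex; exists l.
by exists B => n; exact: (hB n).
Qed.

Lemma convex_functionP {V : normedModType R} (g : V -> R) :
  convex_function [set: convex_lmodType V] g -> convex_on_line g.
Proof.
move=> cg x y s s0 s1.
by have := cg (Itv01 s0 s1) x y; rewrite !inE => /(_ Logic.I Logic.I).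
Qed.

Lemma convex_setP {V : normedModType R} (K : set V) :
  convex_set (K : set (convex_lmodType V)) -> segment_closed K.
Proof.
move=> cK x y s Kx Ky s0 s1.
by have := cK x y (Itv01 s0 s1); rewrite !inE => /(_ Kx Ky).
Qed.

Lemma evaluation_functional {V : normedModType R} (v : V) :
  exists F : dual R (dual R V), forall l, F l = <| l, v |>.
Proof.
apply: (@bounded_opI _ _ R^o (fun l : dual R V => <| l, v |>) `|v|) => // l.
by rewrite mulrC; exact: pairing_le.
Qed.

Lemma norm_fst_le {U W : normedModType R} (x : U * W) : `|x.1| <= `|x|.
Proof. by rewrite (@prod_normE R U W x) le_max lexx. Qed.

Lemma norm_snd_le {U W : normedModType R} (x : U * W) : `|x.2| <= `|x|.
Proof. by rewrite (@prod_normE R U W x) le_max lexx orbT. Qed.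

Lemma norm_quadruple_le {E X Y Z : normedModType R} (p q : E * X * Y * Z) :
  [/\ `|p.1.1.1 - q.1.1.1| <= `|p - q|, `|p.1.1.2 - q.1.1.2| <= `|p - q|,
      `|p.1.2 - q.1.2| <= `|p - q| & `|p.2 - q.2| <= `|p - q|].
Proof.
have h1 := norm_fst_le (p - q); have h2 := norm_fst_le (p - q).1.
split.
- exact: le_trans (norm_fst_le (p - q).1.1) (le_trans h2 h1).
- exact: le_trans (norm_snd_le (p - q).1.1) (le_trans h2 h1).
- exact: le_trans (norm_snd_le (p - q).1) h1.
- exact: norm_snd_le (p - q).
Qed.

Lemma norm_quadruple_sum {E X Y Z : normedModType R} (p : E * X * Y * Z) :
  `|p| <= `|p.1.1.1| + `|p.1.1.2| + `|p.1.2| + `|p.2|.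
Proof.
rewrite (@prod_normE R _ _ p) (@prod_normE R _ _ p.1) (@prod_normE R _ _ p.1.1).
have := normr_ge0 p.1.1.1; have := normr_ge0 p.1.1.2.
have := normr_ge0 p.1.2; have := normr_ge0 p.2.
by rewrite !ge_max => *; do ![apply/andP; split]; lra.
Qed.

Lemma cvg_quadruple {E X Y Z : normedModType R} (p_ : nat -> E * X * Y * Z)
    (p : E * X * Y * Z) : p_ @ \oo --> p ->
  [/\ (fun n => (p_ n).1.1.1) @ \oo --> p.1.1.1,
      (fun n => (p_ n).1.1.2) @ \oo --> p.1.1.2,
      (fun n => (p_ n).1.2) @ \oo --> p.1.2 & (fun n => (p_ n).2) @ \oo --> p.2].
Proof.
move=> /cvgrPdist_lt pp.
split; apply/cvgrPdist_lt => e e0; apply: filterS (pp e e0) => n;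
  apply: le_lt_trans; by have [] := norm_quadruple_le p (p_ n).
Qed.

(** Weak continuity in the dual is tested against the bidual, where [v] acts by evaluation. *)
Lemma demicontinuous_near {V : normedModType R} (B : V -> dual R V) w v e :
  demicontinuous B -> 0 < e ->
  exists2 d, 0 < d & forall u, `|w - u| < d -> `|<| B w, v |> - <| B u, v |>| < e.
Proof.
move=> /demicontinuousP cB e0; have [F FE] := evaluation_functional v.
have /cvgrPdist_lt/(_ e e0)/nbhs_ballP[d /= d0 dB] := cB F w.
exists d => // u wu; rewrite -!FE; apply: (dB u).
by rewrite -ball_normE.
Qed.

Lemma weak_cvg_segment {V : normedModType R} (v w : V) :
  weak_cvg (fun n => n.+1%:R^-1 *: v + (1 - n.+1%:R^-1) *: w) w.
Proof.
apply/weak_cvgP => l.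
have -> : l \o (fun n => n.+1%:R^-1 *: v + (1 - n.+1%:R^-1) *: w) =
    (fun n => l w + n.+1%:R^-1 * <| l, v - w |>).
  apply/funext => n /=.
  have -> : n.+1%:R^-1 *: v + (1 - n.+1%:R^-1) *: w = w + n.+1%:R^-1 *: (v - w).
    by rewrite scalerBl scale1r scalerBr addrCA.
  by rewrite linearD linearZ.
rewrite -[X in _ --> X]addr0; apply: cvgD; first exact: cvg_cst.
rewrite -[X in _ --> X](mul0r <| l, v - w |>).
by apply: cvgM; [exact: cvg_harmonic|exact: cvg_cst].
Qed.

Lemma pairing_cvg {V : normedModType R} (l_ : nat -> dual R V) l (w_ : nat -> V) w C :
  l_ @ \oo --> l -> weak_cvg w_ w -> (forall n, `|w_ n| <= C) ->
  (fun n => <| l_ n, w_ n |>) @ \oo --> <| l, w |>.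
Proof.
move=> ll /weak_cvgP/(_ l) lw wC.
have -> : (fun n => <| l_ n, w_ n |>) =
    (fun n => <| l_ n - l, w_ n |> + <| l, w_ n |>).
  by apply/funext => n; rewrite /pairing -[X in X + _]/(l_ n (w_ n) - l (w_ n)) subrK.
rewrite -[X in _ --> X]add0r; apply: cvgD; last exact: lw.
apply/cvgrPdist_lt => e e0.
have C1 : 0 < C + 1 by rewrite ltr_wpDl// (le_trans _ (wC 0%N)).
have eC : 0 < e / (C + 1) by rewrite divr_gt0.
move/cvgrPdist_lt : ll => /(_ _ eC); apply: filterS => n.
rewrite ltr_pdivlMr// sub0r normrN distrC => h.
apply: le_lt_trans (pairing_le _ _) _; apply: le_lt_trans h.
by rewrite ler_wpM2l// (le_trans (wC n))// lerDl.
Qed.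

End SequenceLemmas.

(** * The inequality with frozen time and history *)

Section PointwiseProblem.
Context {R : realType} {T : R} {E X Y Z V : normedModType R}.
Context (A : R -> E -> V -> dual R V) (f : R -> X -> dual R V).
Context (phi : R -> Y -> V -> V -> R) (j : R -> Z -> X -> R).
Context (K : set V) (M : bounded_op V X).
Context {mA mA' Lf alpha_phi beta_phi : R}.
Context {c_phi1 c_phi2 : R -> R} {c3 : R} {c0j : R -> R} {c1j c2j mj m1 : R}.
Hypothesis V_sep : separable V.
Hypothesis V_refl : reflexive_space V.
Hypothesis A_cont : forall v,
  {within `[0, T]%classic `*` [set: E], continuous (fun p => A p.1 p.2 v)}.
Hypothesis A_demi : forall t l, t \in `[0, T] -> demicontinuous (A t l).
Hypothesis mA'_ge0 : 0 <= mA'.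
Hypothesis A_mono : forall t l1 l2 v1 v2, t \in `[0, T] ->
  mA * `|v1 - v2| ^+ 2 - mA' * `|l1 - l2| * `|v1 - v2| <=
  <| A t l1 v1 - A t l2 v2, v1 - v2 |>.
Hypothesis f_cont : forall xi, {within `[0, T]%classic, continuous (f ^~ xi)}.
Hypothesis Lf_gt0 : 0 < Lf.
Hypothesis f_lip : forall t xi1 xi2, t \in `[0, T] ->
  `|f t xi1 - f t xi2| <= Lf * `|xi1 - xi2|.
Hypothesis phi_convex : forall t eta w, t \in `[0, T] ->
  convex_function [set: convex_lmodType V] (phi t eta w).
Hypothesis alpha_phi_ge0 : 0 <= alpha_phi.
Hypothesis beta_phi_ge0 : 0 <= beta_phi.
Hypothesis phi_ineq : forall t eta1 eta2 w1 w2 v1 v2, t \in `[0, T] ->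
  phi t eta1 w1 v2 - phi t eta1 w1 v1 + phi t eta2 w2 v1 - phi t eta2 w2 v2 <=
  alpha_phi * `|w1 - w2| * `|v1 - v2| + beta_phi * `|eta1 - eta2| * `|v1 - v2|.
Hypothesis c_phi1_cont : {within `[0, T]%classic, continuous c_phi1}.
Hypothesis phi_lip : forall t eta w v1 v2, t \in `[0, T] ->
  phi t eta w v1 - phi t eta w v2 <=
  (c_phi1 t + c_phi2 `|w| + c3 * `|eta|) * `|v1 - v2|.
Hypothesis phi_limsup : forall v (t_ : nat -> R) t
    (eta_ : nat -> Y) eta (w_ : nat -> V) w,
  (forall n, t_ n \in `[0, T]) -> t \in `[0, T] ->
  t_ @ \oo --> t -> eta_ @ \oo --> eta -> weak_cvg w_ w ->
  (limn_esup (fun n => (phi (t_ n) (eta_ n) (w_ n) v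
                        - phi (t_ n) (eta_ n) (w_ n) (w_ n))%:E) <=
   (phi t eta w v - phi t eta w w)%:E)%E.
Hypothesis j_loclip : forall t zeta, t \in `[0, T] -> locally_lipschitz (j t zeta).
Hypothesis c0j_cont : {within `[0, T]%classic, continuous c0j}.
Hypothesis j_growth : forall t zeta v, t \in `[0, T] ->
  (set_norm (clarke_subdiff (j t zeta) v) <=
   (c0j t + c1j * `|zeta| + c2j * `|v|)%:E)%E.
Hypothesis mj_ge0 : 0 <= mj.
Hypothesis m1_ge0 : 0 <= m1.
Hypothesis j_ineq : forall t zeta1 zeta2 v1 v2, t \in `[0, T] ->
  clarke_deriv (j t zeta1) v1 (v2 - v1) + clarke_deriv (j t zeta2) v2 (v1 - v2) <=
  mj * `|v1 - v2| ^+ 2 + m1 * `|zeta1 - zeta2| * `|v1 - v2|.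
Hypothesis j_limsup : forall v (t_ : nat -> R) t
    (zeta_ : nat -> Z) zeta (w_ : nat -> V) w,
  (forall n, t_ n \in `[0, T]) -> t \in `[0, T] ->
  t_ @ \oo --> t -> zeta_ @ \oo --> zeta -> weak_cvg w_ w ->
  (limn_esup (fun n =>
     (clarke_deriv (j (t_ n) (zeta_ n)) (M v) (M v - M (w_ n)))%:E) <=
   (clarke_deriv (j t zeta) (M v) (M v - M w))%:E)%E.
Hypothesis K_neq0 : K !=set0.
Hypothesis K_closed : closed K.
Hypothesis K_convex : convex_set (K : set (convex_lmodType V)).
Hypothesis smallness : mj * `|M| ^+ 2 + alpha_phi < mA.

(* The parameter [p] gathers the values of the four history-dependent operators. *)
Local Notation P := (E * X * Y * Z)%type.

Definition gap t (p : P) w v : R :=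
  <| A t p.1.1.1 w - f t p.1.1.2, v - w |>
  + phi t p.1.2 w v - phi t p.1.2 w w
  + clarke_deriv (j t p.2) (M w) (M v - M w).

Definition solves t p w := K w /\ forall v, K v -> 0 <= gap t p w v.

(** The monotonicity of [A] left over after the defects of [phi] and of [j] composed with [M]; [Cp]
    collects the Lipschitz constants in the history parameter. *)
Let m := mA - alpha_phi - mj * `|M| ^+ 2.
Let Cp := mA' + Lf + beta_phi + m1 * `|M|.

Let m_gt0 : 0 < m. Proof. by rewrite /m; move: smallness; lra. Qed.

Let normM v : `|M v| <= `|M| * `|v|. Proof. exact: op_normP. Qed.

Let pairingBr (l : dual R V) x y : <| l, x - y |> = <| l, x |> - <| l, y |>.
Proof. exact: linearB. Qed.

Let pairingBl (l k : dual R V) x : <| l - k, x |> = <| l, x |> - <| k, x |>.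
Proof. by []. Qed.

Let pairingZr (l : dual R V) s x : <| l, s *: x |> = s * <| l, x |>.
Proof. exact: linearZ. Qed.

Let pairingNr (l : dual R V) x : <| l, - x |> = - <| l, x |>.
Proof. exact: linearN. Qed.

Let clarke_sub t zeta x : t \in `[0, T] -> sublinear (clarke_deriv (j t zeta) x).
Proof. by move=> tT; exact: clarke_deriv_sublinear (j_loclip zeta tT). Qed.

Let gap_diag t p w : t \in `[0, T] -> gap t p w w = 0.
Proof.
move=> tT; rewrite /gap !subrr (sublinear0 (clarke_sub p.2 (M w) tT)).
by rewrite [<| _, 0 |>]linear0 add0r subrr addr0.
Qed.

Let clarke_mono t zeta1 zeta2 w1 w2 : t \in `[0, T] ->
  clarke_deriv (j t zeta1) (M w1) (M w2 - M w1) +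
  clarke_deriv (j t zeta2) (M w2) (M w1 - M w2) <=
  mj * `|M| ^+ 2 * `|w1 - w2| ^+ 2 + m1 * `|zeta1 - zeta2| * (`|M| * `|w1 - w2|).
Proof.
move=> tT; apply: le_trans (j_ineq _ _ _ _ tT) _.
have h : `|M w1 - M w2| <= `|M| * `|w1 - w2| by rewrite -linearB; exact: normM.
apply: lerD.
  by rewrite -mulrA -exprMn ler_wpM2l// lerXn2r ?nnegrE// (le_trans _ h).
by rewrite ler_wpM2l// mulr_ge0.
Qed.

(** Allowing two parameters lets one estimate serve twice: [p1 = p2] is strong monotonicity, and the
    general case gives Lipschitz dependence on [p]. *)
Lemma gap_mono t p1 p2 w1 w2 : t \in `[0, T] ->
  gap t p1 w1 w2 + gap t p2 w2 w1 <=
  - (m * `|w1 - w2| ^+ 2) + Cp * `|p1 - p2| * `|w1 - w2|.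
Proof.
move=> tT; rewrite /gap; have [] := norm_quadruple_le p1 p2.
have := normr_ge0 (p1 - p2); have := normr_ge0 (w1 - w2).
set q := `|p1 - p2|; set d := `|w1 - w2| => d0 q0.
set l1 := p1.1.1.1; set x1 := p1.1.1.2; set e1 := p1.1.2; set z1 := p1.2.
set l2 := p2.1.1.1; set x2 := p2.1.1.2; set e2 := p2.1.2; set z2 := p2.2.
move=> lq xq eq zq.
have := clarke_mono z1 z2 w1 w2 tT; have := phi_ineq e1 e2 w1 w2 w1 w2 tT.
have := A_mono l1 l2 w1 w2 tT.
have : <| f t x1 - f t x2, w1 - w2 |> <= Lf * q * d.
  apply: le_trans (ler_norm _) _; apply: le_trans (pairing_le _ _) _.
  apply: ler_wpM2r => //; apply: le_trans (f_lip _ _ tT) _.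
  by apply: ler_wpM2l => //; exact: ltW.
rewrite -[w2 - w1]opprB !(pairingBl, pairingNr) -/d.
have h1 : mA' * `|l1 - l2| * d <= mA' * q * d.
  by apply: ler_wpM2r => //; exact: ler_wpM2l.
have h2 : beta_phi * `|e1 - e2| * d <= beta_phi * q * d.
  by apply: ler_wpM2r => //; exact: ler_wpM2l.
have h3 : m1 * `|z1 - z2| * (`|M| * d) <= m1 * q * (`|M| * d).
  by apply: ler_wpM2r; [exact: mulr_ge0|exact: ler_wpM2l].
move: h1 h2 h3; rewrite /m /Cp; lra.
Qed.

Let gap_convex t p w : t \in `[0, T] -> convex_on_line (gap t p w).
Proof.
move=> tT x y s s0 s1; rewrite /gap.
have affine (U : lmodType R) (a b c : U) :
    s *: a + (1 - s) *: b - c = s *: (a - c) + (1 - s) *: (b - c).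
  rewrite !scalerBr addrACA -opprD -scalerDl.
  by rewrite addrCA subrr addr0 scale1r.
have [cD cZ] := clarke_sub p.2 (M w) tT.
have cZ' k u : 0 <= k -> clarke_deriv (j t p.2) (M w) (k *: u) <=
    k * clarke_deriv (j t p.2) (M w) u.
  rewrite le_eqVlt => /predU1P[<-|]; last exact: cZ.
  by rewrite scale0r mul0r (sublinear0 (clarke_sub p.2 (M w) tT)).
rewrite linearD !linearZ !affine.
have -> : <| A t p.1.1.1 w - f t p.1.1.2, s *: (x - w) + (1 - s) *: (y - w) |> =
    s * <| A t p.1.1.1 w - f t p.1.1.2, x - w |> +
    (1 - s) * <| A t p.1.1.1 w - f t p.1.1.2, y - w |>.
  by rewrite -!pairingZr; exact: linearD.
have := cD (s *: (M x - M w)) ((1 - s) *: (M y - M w)).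
have := cZ' s (M x - M w) s0; have := cZ' (1 - s) (M y - M w) ltac:(by rewrite subr_ge0).
have := convex_functionP (phi_convex p.1.2 w tT) x y s0 s1.
rewrite /=; lra.
Qed.

Let clarkeB_le t zeta w x y : t \in `[0, T] ->
  clarke_deriv (j t zeta) (M w) (M x - M w) -
  clarke_deriv (j t zeta) (M w) (M y - M w) <=
  (c0j t + c1j * `|zeta| + c2j * `|M w|) * (`|M| * `|x - y|).
Proof.
move=> tT; have [cD _] := clarke_sub zeta (M w) tT.
have := cD (M (x - y)) (M y - M w); rewrite linearB addrA subrK => h.
have := clarke_deriv_le_growth (M (x - y)) (j_loclip zeta tT) (j_growth zeta (M w) tT).
(* The growth bound dominates the norm of some subgradient, hence is nonnegative. *)
have c0 : 0 <= c0j t + c1j * `|zeta| + c2j * `|M w|.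
  have [l [ld _]] := clarke_deriv_support (M w) 0 (j_loclip zeta tT).
  rewrite -lee_fin; apply: le_trans (j_growth zeta (M w) tT).
  apply: le_trans (_ : (`|l|%:E <= _)%E); first by rewrite lee_fin.
  by apply: ereal_sup_ubound; exists l.
have : (c0j t + c1j * `|zeta| + c2j * `|M w|) * `|M (x - y)| <=
  (c0j t + c1j * `|zeta| + c2j * `|M w|) * (`|M| * `|x - y|) by rewrite ler_wpM2l.
rewrite linearB; lra.
Qed.

Let gap_growth t (p : P) w : R := `|A t p.1.1.1 w - f t p.1.1.2|
  + (c_phi1 t + c_phi2 `|w| + c3 * `|p.1.2|)
  + (c0j t + c1j * `|p.2| + c2j * `|M w|) * `|M|.

Let gap_lip t p w x y : t \in `[0, T] ->
  gap t p w x - gap t p w y <= gap_growth t p w * `|x - y|.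
Proof.
move=> tT; rewrite /gap /gap_growth.
have := clarkeB_le p.2 w x y tT; have := phi_lip p.1.2 w x y tT.
have : <| A t p.1.1.1 w - f t p.1.1.2, x - y |> <=
    `|A t p.1.1.1 w - f t p.1.1.2| * `|x - y|.
  by apply: le_trans (ler_norm _) _; exact: pairing_le.
rewrite !pairingBr; lra.
Qed.

(* Along [w + s (v - w)], [s = 1 / (n + 1)], the terms of the inequality that are
   not controlled by monotonicity are upper semicontinuous. *)
Let segment_usc t (p : P) w v e : t \in `[0, T] -> 0 < e ->
  \forall n \near \oo, forall s, s = n.+1%:R^-1 ->
    <| A t p.1.1.1 (s *: v + (1 - s) *: w), v - w |> <= <| A t p.1.1.1 w, v - w |> + e /\
    clarke_deriv (j t p.2) (M (s *: v + (1 - s) *: w)) (M v - M w) <=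
      clarke_deriv (j t p.2) (M w) (M v - M w) + e.
Proof.
move=> tT e0.
have [d1 d10 h1] := demicontinuous_near w (v - w) (@A_demi t p.1.1.1 tT) e0.
have [d2 d20 h2] := clarke_deriv_usc (M w) (M v - M w) (j_loclip p.2 tT) e0.
pose N := `|v - w| + `|M v - M w| + 1.
have N0 : 0 < N by rewrite ltr_wpDl// addr_ge0.
have d0 : 0 < Num.min d1 d2 / N by rewrite divr_gt0// lt_min d10.
near=> n => s sE.
have s0 : 0 < s by rewrite sE invr_gt0.
have : s < Num.min d1 d2 / N by rewrite sE; near: n; exact: near_infty_natSinv_lt (PosNum d0).
rewrite ltr_pdivlMr// lt_min => /andP[sd1 sd2].
have sv : 0 <= s * `|v - w| by rewrite mulr_ge0// ltW.
have sMv : 0 <= s * `|M v - M w| by rewrite mulr_ge0// ltW.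
have E1 (U : lmodType R) (a b : U) : b - (s *: a + (1 - s) *: b) = - (s *: (a - b)).
  rewrite scalerBl scale1r addrCA -scalerBr opprD addrA subrr add0r.
  by [].
split.
  have := h1 (s *: v + (1 - s) *: w); rewrite E1 normrN normrZ gtr0_norm// ltr_norml.
  have -> : s * `|v - w| < d1 by move: sd1; rewrite /N; lra.
  by move=> /(_ isT)/andP[]; lra.
apply: h2; rewrite linearD !linearZ E1 normrN normrZ gtr0_norm//.
by move: sd2; rewrite /N; lra.
Unshelve. all: by end_near. Qed.

Let gap_hemi t p w v e : t \in `[0, T] -> 0 < e ->
  exists s, [/\ 0 < s, s <= 1 & gap t p (s *: v + (1 - s) *: w) v <= gap t p w v + e].
Proof.
move=> tT e0; have e4 : 0 < e / 4 by rewrite divr_gt0.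
(* The pairing and Clarke terms acquire a factor 1 - s; [b] controls what this costs, at most s b <
   e / 4. The other three quarters of [e] go to [A], [j] and [phi]. *)
pose b := `|<| A t p.1.1.1 w - f t p.1.1.2, v - w |> +
  clarke_deriv (j t p.2) (M w) (M v - M w)|.
have b0 : 0 <= b by exact: normr_ge0.
have b1 : 0 < e / 4 / (b + 1) by rewrite divr_gt0// ltr_wpDl.
have hphi := phi_limsup v (fun=> tT) tT (cvg_cst t) (cvg_cst p.1.2)
  (@weak_cvg_segment _ _ v w).
have {}hphi := limn_esup_near (hphi _ _) e4.
near \oo => n; exists n.+1%:R^-1; split.
- by rewrite invr_gt0.
- by rewrite invf_le1// ler1n.
have [hA hj] : <| A t p.1.1.1 (n.+1%:R^-1 *: v + (1 - n.+1%:R^-1) *: w), v - w |> <=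
      <| A t p.1.1.1 w, v - w |> + e / 4 /\
    clarke_deriv (j t p.2) (M (n.+1%:R^-1 *: v + (1 - n.+1%:R^-1) *: w)) (M v - M w) <=
      clarke_deriv (j t p.2) (M w) (M v - M w) + e / 4.
  have : forall s, s = n.+1%:R^-1 ->
    <| A t p.1.1.1 (s *: v + (1 - s) *: w), v - w |> <= <| A t p.1.1.1 w, v - w |> + e / 4 /\
    clarke_deriv (j t p.2) (M (s *: v + (1 - s) *: w)) (M v - M w) <=
      clarke_deriv (j t p.2) (M w) (M v - M w) + e / 4.
    by near: n; exact: segment_usc.
  by apply.
have : phi t p.1.2 (n.+1%:R^-1 *: v + (1 - n.+1%:R^-1) *: w) v -
    phi t p.1.2 (n.+1%:R^-1 *: v + (1 - n.+1%:R^-1) *: w)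
      (n.+1%:R^-1 *: v + (1 - n.+1%:R^-1) *: w) <=
    phi t p.1.2 w v - phi t p.1.2 w w + e / 4.
  by near: n; exact: hphi.
have : n.+1%:R^-1 < e / 4 / (b + 1) by near: n; exact: near_infty_natSinv_lt (PosNum b1).
have : n.+1%:R^-1 <= 1 :> R by rewrite invf_le1// ler1n.
have : 0 < n.+1%:R^-1 :> R by rewrite invr_gt0.
move: hA hj; set s := n.+1%:R^-1; set vs := _ + _ => hA hj s0 s1.
rewrite ltr_pdivlMr ?ltr_wpDl// => sb hphi'; rewrite /gap.
have E1 (U : lmodType R) (x y : U) : x - (s *: x + (1 - s) *: y) = (1 - s) *: (x - y).
  by rewrite opprD addrA scalerBr -[X in X - _ - _]scale1r -scalerBl.
have -> : M v - M vs = (1 - s) *: (M v - M w) by rewrite linearD !linearZ E1.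
have -> : v - vs = (1 - s) *: (v - w) by exact: E1.
have hj' : clarke_deriv (j t p.2) (M vs) ((1 - s) *: (M v - M w)) <=
    (1 - s) * clarke_deriv (j t p.2) (M vs) (M v - M w).
  move: s1; rewrite le_eqVlt => /predU1P[->|s1].
    by rewrite subrr scale0r mul0r (sublinear0 (clarke_sub p.2 _ tT)).
  by apply: (clarke_sub p.2 _ tT).2; rewrite subr_gt0.
rewrite pairingZr !pairingBl.
have s10 : 0 <= 1 - s by rewrite subr_ge0.
have := ler_wpM2l s10 hA; have := ler_wpM2l s10 hj.
have bE : - (s * b) <= s * (<| A t p.1.1.1 w - f t p.1.1.2, v - w |> +
    clarke_deriv (j t p.2) (M w) (M v - M w)).
  rewrite -mulrN; apply: ler_wpM2l; first exact: ltW.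
  by rewrite lerNl /b -normrN ler_norm.
have se : 0 <= s * e by rewrite mulr_ge0 ?ltW.
move: bE sb hj' hphi'; rewrite pairingBl; lra.
Unshelve. all: by end_near. Qed.

Lemma solution_exists t p : t \in `[0, T] -> exists w, solves t p w.
Proof.
move=> tT; have [|||||||||w Kw hw] := @equilibrium_exists R V V_refl K (gap t p) m.
- exact: K_closed.
- exact: convex_setP.
- exact: K_neq0.
- exact: m_gt0.
- by move=> v; exact: gap_diag.
- move=> v w; have := gap_mono p p v w tT.
  by rewrite subrr normr0 mulr0 mul0r addr0.
- by move=> v; exact: gap_convex.
- by move=> v; exists (gap_growth t p v) => x y; exact: gap_lip.
- by move=> w v e e0; exact: gap_hemi.
by exists w.
Qed.

(** Each solution is a test point for the other one; add the two inequalities and divide by |w1 -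
    w2|. *)
Lemma solution_lip t p1 p2 w1 w2 : t \in `[0, T] ->
  solves t p1 w1 -> solves t p2 w2 -> `|w1 - w2| <= Cp / m * `|p1 - p2|.
Proof.
move=> tT [Kw1 h1] [Kw2 h2]; rewrite mulrAC ler_pdivlMr//.
have := gap_mono p1 p2 w1 w2 tT; have := h1 _ Kw2; have := h2 _ Kw1.
have := normr_ge0 (w1 - w2); rewrite le_eqVlt => /predU1P[<- _ _ _|d0].
  by rewrite mul0r mulr_ge0// /Cp !addr_ge0// ?mulr_ge0// ltW.
by move=> ? ? ?; rewrite -(ler_pM2r d0); lra.
Qed.

Lemma solution_unique t p w1 w2 : t \in `[0, T] ->
  solves t p w1 -> solves t p w2 -> w1 = w2.
Proof.
move=> tT s1 s2; apply/eqP; rewrite -subr_eq0 -normr_le0.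
by have := solution_lip tT s1 s2; rewrite subrr normr0 mulr0.
Qed.

Lemma solution_lipschitz : exists2 L : R, 0 <= L &
  forall t p1 p2 w1 w2, t \in `[0, T] -> solves t p1 w1 -> solves t p2 w2 ->
    `|w1 - w2| <= L * `|p1 - p2|.
Proof.
exists `|Cp / m| => // t p1 p2 w1 w2 tT s1 s2.
by apply: le_trans (solution_lip tT s1 s2) _; rewrite ler_wpM2r// ler_norm.
Qed.

Lemma solves_dense (k_ : nat -> V) t p w : t \in `[0, T] ->
  (forall x e, K x -> 0 < e -> exists n, `|x - k_ n| < e) ->
  K w -> (forall n, 0 <= gap t p w (k_ n)) -> solves t p w.
Proof.
move=> tT kP Kw hk; split=> // v Kv; apply/ler_addgt0Pr => e e0.
have g0 : 0 < `|gap_growth t p w| + 1 by rewrite ltr_wpDl.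
have eg : 0 < e / (`|gap_growth t p w| + 1) by rewrite divr_gt0.
have [n vn] := kP _ _ Kv eg; apply: le_trans (hk n) _; rewrite -lerBlDl.
apply: le_trans (gap_lip p w (k_ n) v tT) _; rewrite distrC.
move: vn; rewrite ltr_pdivlMr// => /ltW; apply: le_trans.
by rewrite mulrC ler_wpM2l// ler_wpDr// ler_norm.
Qed.

(** A mixed Minty form, shaped by the limsup hypotheses: [A] and the Clarke derivative sit at the
    test point [v], while [phi] keeps [w]. The direction [M v - M w] results from -j0(h) <= j0(-h)
    for a sublinear j0. *)
Let minty_bound t (p : P) w v := <| A t p.1.1.1 v - f t p.1.1.2, v - w |>
  + (phi t p.1.2 w v - phi t p.1.2 w w) + clarke_deriv (j t p.2) (M v) (M v - M w).

Let minty_ineq t p w v : t \in `[0, T] -> solves t p w -> K v ->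
  m * `|w - v| ^+ 2 <= minty_bound t p w v.
Proof.
move=> tT [Kw hw] Kv; have := hw _ Kv; rewrite /gap /minty_bound.
have := A_mono p.1.1.1 p.1.1.1 w v tT; rewrite subrr normr0 mulr0 mul0r subr0.
have := clarke_mono p.2 p.2 w v tT; rewrite subrr normr0 mulr0 mul0r addr0.
have := sublinearN (M v - M w) (clarke_sub p.2 (M v) tT); rewrite opprB.
rewrite -[v - w]opprB !(pairingBl, pairingNr) /m.
have : 0 <= alpha_phi * `|w - v| ^+ 2 by rewrite mulr_ge0.
lra.
Qed.

Let A_seq (t_ : nat -> R) (t : R) (p_ : nat -> P) (p : P) v :
  (forall n, t_ n \in `[0, T]) -> t \in `[0, T] ->
  t_ @ \oo --> t -> p_ @ \oo --> p ->
  (fun n => A (t_ n) (p_ n).1.1.1 v) @ \oo --> A t p.1.1.1 v.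
Proof.
move=> tT tT' tt pp.
have [pl _ _ _] := cvg_quadruple pp.
have h : (fun n => (t_ n, (p_ n).1.1.1)) @ \oo --> (t, p.1.1.1).
  exact: (cvg_pair tt pl).
have D n : (`[0, T]%classic `*` [set: E]) (t_ n, (p_ n).1.1.1) by split=> //=; exact: tT.
have D' : (`[0, T]%classic `*` [set: E]) (t, p.1.1.1) by split=> //=; exact: tT'.
exact: (within_continuous_seq (@A_cont v) D D' h).
Qed.

Let f_seq (t_ : nat -> R) (t : R) (p_ : nat -> P) (p : P) :
  (forall n, t_ n \in `[0, T]) -> t \in `[0, T] ->
  t_ @ \oo --> t -> p_ @ \oo --> p ->
  (fun n => f (t_ n) (p_ n).1.1.2) @ \oo --> f t p.1.1.2.
Proof.
move=> tT tT' tt pp; have ft := within_continuous_seq (@f_cont p.1.1.2) tT tT' tt.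
apply/cvgrPdist_lt => e e0; have e2 : 0 < e / 2 by rewrite divr_gt0.
have eL : 0 < e / 2 / Lf by rewrite divr_gt0.
near=> n.
have h1 : `|f t p.1.1.2 - f (t_ n) p.1.1.2| < e / 2.
  by near: n; move/cvgrPdist_lt: ft => /(_ _ e2).
have h2 : `|p - p_ n| < e / 2 / Lf.
  by near: n; move/cvgrPdist_lt: pp => /(_ _ eL).
have [_ h3 _ _] := norm_quadruple_le p (p_ n).
apply: le_lt_trans (ler_distD (f (t_ n) p.1.1.2) _ _) _.
rewrite [ltRHS](splitr e); apply: ltrD => //; apply: le_lt_trans (f_lip _ _ (tT n)) _.
by rewrite mulrC -ltr_pdivlMr//; apply: le_lt_trans h3 h2.
Unshelve. all: by end_near. Qed.

(** With [v] fixed, [A] and [f] converge strongly in the dual and may be paired with a weakly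
    convergent sequence; [phi] and [j] obey only upper limits, so the estimate is one-sided. *)
Let minty_bound_near (t_ : nat -> R) (t : R) (p_ : nat -> P) (p : P)
    (w_ : nat -> V) (w : V) v (C e : R) :
  (forall n, t_ n \in `[0, T]) -> t \in `[0, T] ->
  t_ @ \oo --> t -> p_ @ \oo --> p -> weak_cvg w_ w -> (forall n, `|w_ n| <= C) ->
  0 < e -> \forall n \near \oo, minty_bound (t_ n) (p_ n) (w_ n) v <= minty_bound t p w v + e.
Proof.
move=> tT tT' tt pp ww wC e0; have e3 : 0 < e / 3 by rewrite divr_gt0.
have [_ _ peta pzeta] := cvg_quadruple pp.
have hphi := limn_esup_near (phi_limsup v tT tT' tt peta ww) e3.
have hj := limn_esup_near (j_limsup v tT tT' tt pzeta ww) e3.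
have vw : weak_cvg (fun n => v - w_ n) (v - w).
  apply/weak_cvgP => l; move/weak_cvgP/(_ l): ww => lw.
  rewrite linearB (_ : _ \o _ = fun n => l v - l (w_ n)); last first.
    by apply/funext => n /=; rewrite linearB.
  by apply: cvgB; [exact: cvg_cst|exact: lw].
have vwC n : `|v - w_ n| <= `|v| + C.
  by apply: le_trans (ler_normB _ _) _; rewrite lerD2l.
have hA : (fun n => <| A (t_ n) (p_ n).1.1.1 v - f (t_ n) (p_ n).1.1.2, v - w_ n |>) @ \oo -->
    <| A t p.1.1.1 v - f t p.1.1.2, v - w |>.
  by apply: (pairing_cvg _ vw vwC); apply: cvgB; [exact: A_seq|exact: f_seq].
near=> n; rewrite /minty_bound.
have h1 : phi (t_ n) (p_ n).1.2 (w_ n) v - phi (t_ n) (p_ n).1.2 (w_ n) (w_ n) <=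
    phi t p.1.2 w v - phi t p.1.2 w w + e / 3 by near: n; exact: hphi.
have h2 : clarke_deriv (j (t_ n) (p_ n).2) (M v) (M v - M (w_ n)) <=
    clarke_deriv (j t p.2) (M v) (M v - M w) + e / 3 by near: n; exact: hj.
have : `|<| A t p.1.1.1 v - f t p.1.1.2, v - w |> -
    <| A (t_ n) (p_ n).1.1.1 v - f (t_ n) (p_ n).1.1.2, v - w_ n |>| < e / 3.
  by near: n; move/cvgrPdist_lt: hA => /(_ _ e3).
rewrite ltr_norml; lra.
Unshelve. all: by end_near. Qed.

(** Compare with a fixed [w0] in [K]: strong monotonicity gives m |w_n - w0| <= [gap_growth] at
    [w0], which depends on [n] only through convergent data. *)
Let solution_bounded (t_ : nat -> R) (t : R) (p_ : nat -> P) (p : P) (w_ : nat -> V) :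
  (forall n, t_ n \in `[0, T]) -> t \in `[0, T] ->
  t_ @ \oo --> t -> p_ @ \oo --> p -> (forall n, solves (t_ n) (p_ n) (w_ n)) ->
  exists C : R, forall n, `|w_ n| <= C.
Proof.
move=> tT tT' tt pp sw; have [w0 Kw0] := K_neq0.
have [_ _ peta pzeta] := cvg_quadruple pp.
have [C1 hC1] : exists B : R, forall n,
    `|A (t_ n) (p_ n).1.1.1 w0 - f (t_ n) (p_ n).1.1.2| <= B.
  apply: (@cvg_norm_bounded _ _ _ (A t p.1.1.1 w0 - f t p.1.1.2)).
  by apply: cvgB; [exact: A_seq|exact: f_seq].
have [C2 hC2] : exists B : R, forall n,
    `|c_phi1 (t_ n) + c_phi2 `|w0| + c3 * `|(p_ n).1.2| | <= B.
  apply: (@cvg_norm_bounded _ R^o _ (c_phi1 t + c_phi2 `|w0| + c3 * `|p.1.2|)).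
  apply: cvgD; last by apply: cvgM; [exact: cvg_cst|exact: cvg_norm peta].
  by apply: cvgD; [exact: within_continuous_seq c_phi1_cont tT tT' tt|exact: cvg_cst].
have [C3 hC3] : exists B : R, forall n,
    `|(c0j (t_ n) + c1j * `|(p_ n).2| + c2j * `|M w0|) * `|M| | <= B.
  apply: (@cvg_norm_bounded _ R^o _ ((c0j t + c1j * `|p.2| + c2j * `|M w0|) * `|M|)).
  apply: cvgM; last exact: cvg_cst.
  apply: cvgD; last exact: cvg_cst.
  apply: cvgD; last by apply: cvgM; [exact: cvg_cst|exact: cvg_norm pzeta].
  exact: within_continuous_seq c0j_cont tT tT' tt.
exists (`|w0| + (C1 + C2 + C3) / m) => n.
suff : `|w_ n - w0| <= (C1 + C2 + C3) / m.
  by have := ler_distD w0 (w_ n) 0; rewrite !subr0; lra.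
have [Kn hn] := sw n; rewrite ler_pdivlMr//.
have := gap_mono (p_ n) (p_ n) (w_ n) w0 (tT n); rewrite subrr normr0 mulr0 mul0r addr0.
have := gap_lip (p_ n) w0 w0 (w_ n) (tT n); rewrite gap_diag//.
have := hn _ Kw0; rewrite (distrC w0).
have : gap_growth (t_ n) (p_ n) w0 <= C1 + C2 + C3.
  rewrite /gap_growth; apply: lerD; last exact: le_trans (ler_norm _) (hC3 n).
  by apply: lerD; [exact: hC1|exact: le_trans (ler_norm _) (hC2 n)].
have C0 : 0 <= C1 + C2 + C3.
  have := le_trans (normr_ge0 _) (hC1 n); have := le_trans (normr_ge0 _) (hC2 n).
  by have := le_trans (normr_ge0 _) (hC3 n); move=> *; rewrite !addr_ge0.
set g := gap_growth _ _ _ => gC.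
have := normr_ge0 (w_ n - w0); rewrite le_eqVlt => /predU1P[<- _ _ _|d0 h1 h2 h3].
  by rewrite mul0r.
rewrite -(ler_pM2r d0); have := ler_wpM2r (ltW d0) gC; lra.
Qed.

Let weak_limit_solves (t_ : nat -> R) (t : R) (p_ : nat -> P) (p : P) (w_ : nat -> V) (w : V) :
  (forall n, t_ n \in `[0, T]) -> t \in `[0, T] ->
  t_ @ \oo --> t -> p_ @ \oo --> p -> (forall n, solves (t_ n) (p_ n) (w_ n)) ->
  weak_cvg w_ w -> solves t p w /\ w_ @ \oo --> w.
Proof.
move=> tT tT' tt pp sw ww; have [C wC] := solution_bounded tT tT' tt pp sw.
have Kw : K w.
  have [U [UU oU]] := @ultraFilterLemma nat \oo _.
  apply: (closed_convex_ultra_limit UU (convex_setP K_convex) K_closed K_neq0 (x := w_)).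
    move=> l e e0; apply: oU; move/weak_cvgP/(_ l)/cvgrPdist_lt/(_ e e0): ww.
    by apply: filterS => n; rewrite distrC.
  by apply: oU; apply: filterE => n; exact: (sw n).1.
(* Strong convergence: the Minty bound with test point [w] dominates m |w_n - w|^2, and its limit
   value is 0. *)
split; last first.
  apply/cvgrPdist_lt => e e0.
  have me : 0 < m * e ^+ 2 / 2 by rewrite divr_gt0// mulr_gt0// exprn_gt0.
  have := minty_bound_near w tT tT' tt pp ww wC me; apply: filterS => n.
  have -> : minty_bound t p w w = 0.
    rewrite /minty_bound !subrr (sublinear0 (clarke_sub p.2 (M w) tT')).
    by rewrite [<| _, 0 |>]linear0 !addr0.
  rewrite add0r => /(le_trans (minty_ineq (tT n) (sw n) Kw)) h.
  have : `|w_ n - w| ^+ 2 < e ^+ 2.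
    have e20 : 0 < m * e ^+ 2 by rewrite mulr_gt0// exprn_gt0.
    by rewrite -(ltr_pM2l m_gt0); apply: le_lt_trans h _; lra.
  by rewrite ltr_pXn2r ?nnegrE ?(ltW e0)// distrC.
have minty v : K v -> 0 <= minty_bound t p w v.
  move=> Kv; apply/ler_addgt0Pr => e e0.
  have := minty_bound_near v tT tT' tt pp ww wC e0 => /filter_ex[n].
  apply: le_trans; apply: le_trans (minty_ineq (tT n) (sw n) Kv).
  by rewrite mulr_ge0 ?sqr_ge0// ltW.
(* From Minty back to the inequality: test at [vs] on the segment from [w] to [v], factor out [s],
   and return from [vs] to [w] by [segment_usc]. *)
split=> // v Kv; apply/ler_addgt0Pr => e e0; have e2 : 0 < e / 2 by rewrite divr_gt0.
have := segment_usc p w v tT' e2 => /filter_ex[n /(_ _ erefl)].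
have : n.+1%:R^-1 <= 1 :> R by rewrite invf_le1// ler1n.
have : 0 < n.+1%:R^-1 :> R by rewrite invr_gt0.
set s := n.+1%:R^-1 => s0 s1 [hA hj].
have := minty _ (convex_setP K_convex Kv Kw (ltW s0) s1).
move: hA hj; set vs := _ + _ => hA hj; rewrite /minty_bound /gap.
have E1 (U : lmodType R) (x y : U) : s *: x + (1 - s) *: y - y = s *: (x - y).
  by rewrite scalerBl scale1r scalerBr [y - _]addrC addrA addrK.
have -> : M vs - M w = s *: (M v - M w) by rewrite linearD !linearZ E1.
have -> : vs - w = s *: (v - w) by exact: E1.
have := (clarke_sub p.2 (M vs) tT').2 s (M v - M w) s0.
have := convex_functionP (phi_convex p.1.2 w tT') v w (ltW s0) s1; rewrite -/vs.
rewrite pairingZr !pairingBl => h1 h2 h3.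
suff : 0 <= s * (<| A t p.1.1.1 w, v - w |> - <| f t p.1.1.2, v - w |> +
  phi t p.1.2 w v - phi t p.1.2 w w +
  clarke_deriv (j t p.2) (M w) (M v - M w) + e) by rewrite pmulr_rge0.
have := ler_wpM2l (ltW s0) hA; have := ler_wpM2l (ltW s0) hj; lra.
Qed.

(** If the sequence stayed away from [w] along indices [s], a weakly convergent further subsequence
    would converge strongly to a solution, which is [w] by uniqueness. *)
Theorem solution_cvg (t_ : nat -> R) (t : R) (p_ : nat -> P) (p : P) (w_ : nat -> V) (w : V) :
  (forall n, t_ n \in `[0, T]) -> t \in `[0, T] ->
  t_ @ \oo --> t -> p_ @ \oo --> p -> (forall n, solves (t_ n) (p_ n) (w_ n)) ->
  solves t p w -> w_ @ \oo --> w.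
Proof.
move=> tT tT' tt pp sw sw'; have [C wC] := solution_bounded tT tT' tt pp sw.
apply/cvgrPdist_lt => e e0; apply: contrapT => nw.
have /choice[s sP] N : exists n, (N <= n)%N /\ e <= `|w - w_ n|.
  apply: contrapT => h; apply: nw; exists N => // n /= Nn.
  by rewrite ltNge; apply/negP => en; apply: h; exists n.
have [r [w' [rP rw]]] := weak_subsequence (w_ := w_ \o s) V_sep V_refl (fun n => wC (s n)).
have sr : (fun n => s (r n)) @ \oo --> \oo.
  apply/cvgnyPge => N; exists N => // n /= Nn.
  exact: leq_trans Nn (leq_trans (rP n) (sP (r n)).1).
have tsr : (fun n => t_ (s (r n))) @ \oo --> t by exact: cvg_comp sr tt.
have psr : (fun n => p_ (s (r n))) @ \oo --> p by exact: cvg_comp sr pp.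
have [] := weak_limit_solves (fun n => tT (s (r n))) tT' tsr psr (fun n => sw (s (r n))) rw.
move=> /(solution_unique tT' sw') <- /cvgrPdist_lt/(_ e e0)/filter_ex[n].
by rewrite ltNge (sP (r n)).2.
Qed.

End PointwiseProblem.

(** * Strong measurability *)

Section SimpleFunctions.
Context {R : realType}.

(** Since [s] takes finitely many values, the set is a finite union over them, and [D] may be an
    arbitrary set of values. *)
Lemma simple_fun_bigcup {V : Type} (s : R -> V) (D : set V) (F : V -> set R) :
  simple_fun s -> (forall v, measurable (F v)) ->
  measurable [set t | D (s t) /\ F (s t) t].
Proof.
move=> [fs ms] mF.
have -> : [set t | D (s t) /\ F (s t) t] =
    \bigcup_(v in range s `&` D) (s @^-1` [set v] `&` F v).
  apply/seteqP; split=> [t [Dt Ft]|t [v [_ Dv] [/= sv Ft]]]; last by rewrite sv.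
  by exists (s t).
apply: fin_bigcup_measurable; first exact: finite_setIl.
by move=> v _; exact: measurableI.
Qed.

Lemma simple_fun_comp {V W : Type} (g : V -> W) (s : R -> V) :
  simple_fun s -> simple_fun (g \o s).
Proof.
move=> ss; split=> [|w].
  apply: (@sub_finite_set _ _ (g @` range s)); last by apply: finite_image; case: ss.
  by move=> _ [t _ <-]; exists (s t) => //; exists t.
rewrite (_ : _ @^-1` _ = [set t | (g @^-1` [set w]) (s t) /\ setT t]).
  by apply: (simple_fun_bigcup _ (F := fun=> setT)).
by apply/seteqP; split=> [t|t []].
Qed.

Lemma simple_fun_pair {V W : Type} (s : R -> V) (r : R -> W) :
  simple_fun s -> simple_fun r -> simple_fun (fun t => (s t, r t)).
Proof.
move=> [fs ms] [fr mr]; split=> [|[v w]].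
  apply: (@sub_finite_set _ _ (range s `*` range r)); last exact: finite_setX.
  by move=> _ [t _ <-]; split; exists t.
rewrite (_ : _ @^-1` _ = s @^-1` [set v] `&` r @^-1` [set w]).
  exact: measurableI.
by apply/seteqP; split=> [t [<- <-]|t [/= -> ->]].
Qed.

Lemma simple_fun_cst {V : Type} (v : V) : simple_fun (fun _ : R => v).
Proof.
split=> [|w].
  by apply: (@sub_finite_set _ _ [set v]); [move=> _ [t _ <-]|exact: finite_set1].
have [->|vw] := pselect (v = w).
  by rewrite (_ : _ @^-1` _ = setT)//; apply/seteqP; split.
by rewrite (_ : _ @^-1` _ = set0)//; apply/seteqP; split.
Qed.

Lemma simple_fun_if {V : Type} (S : set R) (s r : R -> V) :
  measurable S -> simple_fun s -> simple_fun r ->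
  simple_fun (fun t => if t \in S then s t else r t).
Proof.
move=> mS [fs ms] [fr mr]; split=> [|v].
  apply: (@sub_finite_set _ _ (range s `|` range r)); last by rewrite finite_setU.
  by move=> _ [t _ <-]; case: ifP => _; [left|right]; exists t.
rewrite (_ : _ @^-1` _ = (S `&` s @^-1` [set v]) `|` (~` S `&` r @^-1` [set v])).
  by apply: measurableU; apply: measurableI => //; exact: measurableC.
apply/seteqP; split=> t /=.
  have [St|St] := pselect (S t); first by rewrite mem_set// => <-; left.
  by rewrite memNset// => <-; right.
by move=> [[St <-]|[St <-]]; [rewrite mem_set|rewrite memNset].
Qed.

End SimpleFunctions.

(** * Strong measurability through distances to points *)

Section StrongMeasurability.
Context {R : realType} (D : set R) (mD : measurable D).

Lemma strongly_measurable_ext {V : normedModType R} (u v : R -> V) :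
  (forall t, D t -> u t = v t) -> strongly_measurable D u -> strongly_measurable D v.
Proof. by move=> uv [s ss su]; exists s => // t Dt; rewrite -uv//; exact: su. Qed.

Lemma strongly_measurable_comp2 {U V W : normedModType R} (g : U -> V -> W)
    (u : R -> U) (v : R -> V) :
  (forall (u_ : nat -> U) (v_ : nat -> V) t, D t ->
    u_ @ \oo --> u t -> v_ @ \oo --> v t ->
    (fun n => g (u_ n) (v_ n)) @ \oo --> g (u t) (v t)) ->
  strongly_measurable D u -> strongly_measurable D v ->
  strongly_measurable D (fun t => g (u t) (v t)).
Proof.
move=> gc [s ss su] [r sr rv]; exists (fun n t => g (s n t) (r n t)).
  move=> n; exact: (simple_fun_comp (fun p => g p.1 p.2) (simple_fun_pair (ss n) (sr n))).
by move=> t Dt; apply: gc => //; [exact: su|exact: rv].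
Qed.

Lemma strongly_measurable_pair {U V : normedModType R} (u : R -> U) (v : R -> V) :
  strongly_measurable D u -> strongly_measurable D v ->
  strongly_measurable D (fun t => (u t, v t)).
Proof.
apply: (strongly_measurable_comp2 (W := (U * V)%type) (g := pair)) => u_ v_ t Dt uu vv.
exact: (cvg_pair uu vv).
Qed.

Lemma strongly_measurableB {V : normedModType R} (u v : R -> V) :
  strongly_measurable D u -> strongly_measurable D v ->
  strongly_measurable D (fun t => u t - v t).
Proof.
apply: (strongly_measurable_comp2 (g := fun x y : V => x - y)) => u_ v_ t Dt uu vv.
exact: cvgB.
Qed.

Lemma strongly_measurable_dist {V : normedModType R} (u : R -> V) x :
  strongly_measurable D u -> measurable_fun D (fun t => `|u t - x|).
Proof.
move=> [s ss su].
apply: (@measurable_fun_cvg _ _ _ _ (fun n t => `|s n t - x|)) => [n|t Dt].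
  move=> _ B mB; apply: measurableI => //.
  rewrite (_ : _ @^-1` _ = [set t | [set v | B `|v - x|] (s n t) /\ setT t]).
    by apply: (simple_fun_bigcup _ (ss n) (F := fun=> setT)).
  by apply/seteqP; split=> [y|y []].
by apply: cvg_norm; apply: cvgB; [exact: su|exact: cvg_cst].
Qed.

Lemma strongly_measurable_norm {V : normedModType R} (u : R -> V) :
  strongly_measurable D u -> measurable_fun D (fun t => `|u t|).
Proof.
move=> mu; rewrite (_ : (fun t => _) = fun t => `|u t - 0|).
  exact: strongly_measurable_dist.
by apply/funext => t; rewrite subr0.
Qed.

(* The simple functions [near n] choose a best approximation among the first
   points of a dense sequence. *)
Lemma dist_strongly_measurable {V : normedModType R} (u : R -> V) :
  separable V -> (forall x, measurable_fun D (fun t => `|u t - x|)) ->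
  strongly_measurable D u.
Proof.
move=> V_sep mu; have [d dP] := separable_seq V_sep.
pose next x (s : R -> V) t :=
  if t \in D `&` [set t | `|u t - x| < `|u t - s t|] then x else s t.
pose near := fix near n := if n is k.+1 then next (d k) (near k) else (fun=> d 0%N).
have m_simple (s : R -> V) : simple_fun s -> measurable_fun D (fun t => `|u t - s t|).
  move=> ss _ B mB.
  rewrite (_ : _ `&` _ = [set t | setT (s t) /\ (D `&` [set y | B `|u y - s t|]) t]).
    apply: (simple_fun_bigcup _ ss (F := fun x => D `&` [set y | B `|u y - x|])).
    by move=> x; exact: mu.
  by apply/seteqP; split=> [y [? ?]|y [_ []]].
have near_simple n : simple_fun (near n).
  elim: n => [|n IH]; first exact: simple_fun_cst.
  apply: simple_fun_if => //; last exact: simple_fun_cst.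
  have mtrue : measurable [set true] by [].
  exact: (measurable_fun_ltr (mu (d n)) (m_simple _ IH) mD mtrue).
have near_le n t : D t -> `|u t - near n.+1 t| <= `|u t - near n t| /\
    `|u t - near n.+1 t| <= `|u t - d n|.
  move=> Dt /=; rewrite /next; case: ifPn => [/set_mem[_ /= h]|h].
    by split; [exact: ltW|].
  split=> //; rewrite leNgt; apply/negP => h'; move/negP: h; apply.
  by apply: mem_set; split.
exists near => // t Dt; apply/cvgrPdist_lt => e e0.
have [k uk] := dP (u t) _ e0; exists k.+1 => // n /= kn.
apply: le_lt_trans uk; rewrite -(subnK kn); elim: (n - k.+1)%N => [|i IH].
  by rewrite add0n; exact: (near_le k t Dt).2.
by apply: le_trans IH; exact: (near_le _ t Dt).1.
Qed.

(** Distances to fixed points are real functions, whose measurability survives pointwise limits;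
    separability recovers strong measurability from them. *)
Lemma strongly_measurable_limit {V : normedModType R} (u_ : nat -> R -> V) (u : R -> V) :
  separable V -> (forall n, strongly_measurable D (u_ n)) ->
  (forall t, D t -> u_ ^~ t @ \oo --> u t) -> strongly_measurable D u.
Proof.
move=> V_sep mu uu; apply: dist_strongly_measurable => // x.
apply: (@measurable_fun_cvg _ _ _ _ (fun n t => `|u_ n t - x|)) => [n|t Dt].
  exact: strongly_measurable_dist.
by apply: cvg_norm; apply: cvgB; [exact: uu|exact: cvg_cst].
Qed.

Lemma strongly_measurable_if {V : normedModType R} (S : set R) (u v : R -> V) :
  measurable S -> strongly_measurable D u -> strongly_measurable D v ->
  strongly_measurable D (fun t => if t \in S then u t else v t).
Proof.
move=> mS [s ss su] [r sr rv].
exists (fun n t => if t \in S then s n t else r n t) => [n|t Dt].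
  exact: simple_fun_if.
by case: ifP => _; [exact: su|exact: rv].
Qed.

Lemma strongly_measurable_cst {V : normedModType R} (x : V) :
  strongly_measurable D (fun _ : R => x).
Proof.
by exists (fun _ _ => x) => [n|t Dt]; [exact: simple_fun_cst|exact: cvg_cst].
Qed.

Lemma strongly_measurable_id : strongly_measurable D (fun t => t : R^o).
Proof.
apply: dist_strongly_measurable => [|x].
  exists (@ratr R @` setT); last exact: dense_rat.
  by apply: (card_le_trans (card_image_le _ _)); exact: countableP.
apply: measurableT_comp; first exact: normr_measurable.
by apply: measurable_funB => //; exact: measurable_cst.
Qed.

(* Sampling [t] itself by simple functions as well makes the composite with a
   jointly continuous map a limit of simple functions. *)
Lemma strongly_measurable_caratheodory {P V : normedModType R} (T : R)
    (F : R -> P -> V) (p : R -> P) :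
  D `<=` `[0, T]%classic ->
  (forall (t_ : nat -> R) (p_ : nat -> P) t, D t -> (forall n, t_ n \in `[0, T]) ->
    t_ @ \oo --> t -> p_ @ \oo --> p t ->
    (fun n => F (t_ n) (p_ n)) @ \oo --> F t (p t)) ->
  strongly_measurable D p -> strongly_measurable D (fun t => F t (p t)).
Proof.
(* Simple approximations of [t] may leave [0,T], where nothing is known of [F]. The projection onto
   the interval is 1-Lipschitz and fixes the points of [D]. *)
move=> DT Fc mp; pose clamp t := Num.max 0 (Num.min t T).
have clamp_lip x y : `|clamp x - clamp y| <= `|x - y|.
  have h a b : a <= b -> 0 <= clamp b - clamp a /\ clamp b - clamp a <= b - a.
    by rewrite /clamp; case: (leP a T); case: (leP b T);
      case: (leP 0 a); case: (leP 0 b); case: (leP 0 T) => *; split; lra.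
  have [/h[? ?]|/ltW/h[? ?]] := leP x y.
    by rewrite distrC (distrC x) !ger0_norm// ?subr_ge0//; lra.
  by rewrite !ger0_norm//; lra.
have h : strongly_measurable D (fun t => F (clamp t) (p t)).
  apply: (strongly_measurable_comp2 (U := R^o) (g := fun t => F (clamp t))) mp.
    move=> t_ p_ t Dt tt pp.
    have clampE : clamp t = t.
      have := DT _ Dt; rewrite /= in_itv/= => /andP[t0 tT].
      by rewrite /clamp min_l// max_r.
    rewrite clampE; apply: (Fc (fun n => clamp (t_ n))) => // [n|].
      have T0 : 0 <= T by have := DT _ Dt; rewrite /= in_itv/= => /andP[]; exact: le_trans.
      by rewrite in_itv/= /clamp le_max lexx/= ge_max T0 ge_min lexx orbT.
    rewrite -[X in _ --> X]clampE; apply/cvgrPdist_lt => e e0.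
    move/cvgrPdist_lt: tt => /(_ e e0); apply: filterS => n; apply: le_lt_trans.
    rewrite /clamp; exact: clamp_lip.
  exact: strongly_measurable_id.
apply: strongly_measurable_ext h => t Dt; congr F.
have := DT _ Dt; rewrite /= in_itv/= => /andP[t0 tT].
by rewrite /clamp min_l// max_r.
Qed.

End StrongMeasurability.

(** * Volterra operators on L^2 *)

Section RealLemmas.
Context {R : realType}.

Lemma geometric_le0 (x c : R) : (forall n, x <= c * (1 / 2) ^+ n) -> x <= 0.
Proof.
move=> h; apply/ler_addgt0Pr => e e0; rewrite add0r.
have z1 : `|1 / 2 : R| < 1 by rewrite ger0_norm; lra.
have /cvgrPdist_lt/(_ e e0)/filter_ex[n] := cvg_geometric c z1.
rewrite sub0r normrN => hn; apply: le_trans (h n) _.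
by apply: le_trans (ler_norm _) (ltW _); exact: hn.
Qed.

Lemma geometric_cvg {W : completeNormedModType R} (x : nat -> W) (Q : R) :
  (forall n, `|x n.+1 - x n| <= Q * (1 / 2) ^+ n) ->
  exists l, x @ \oo --> l /\ forall n, `|l - x n| <= 2 * Q * (1 / 2) ^+ n.
Proof.
move=> hx.
have Q0 : 0 <= Q by have := le_trans (normr_ge0 _) (hx 0%N); rewrite expr0 mulr1.
have e0 n : 0 <= (1 / 2 : R) ^+ n by rewrite exprn_ge0//; lra.
(* The factor 1 - (1/2)^i, the exact partial geometric sum, is what lets the induction close. *)
have far n i : `|x (i + n)%N - x n| <= 2 * Q * (1 / 2) ^+ n * (1 - (1 / 2) ^+ i).
  elim: i => [|i IH]; first by rewrite add0n subrr normr0 expr0 subrr mulr0.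
  have := hx (i + n)%N; have := ler_distD (x (i + n)%N) (x (i.+1 + n)%N) (x n).
  by rewrite addSn exprD exprS; move: IH; lra.
have dist n m : (n <= m)%N -> `|x m - x n| <= 2 * Q * (1 / 2) ^+ n.
  move=> nm; have := far n (m - n)%N; rewrite subnK// => /le_trans; apply.
  by rewrite ler_piMr ?mulr_ge0// gerDl oppr_le0.
have z1 : `|1 / 2 : R| < 1 by rewrite ger0_norm; lra.
have : cvg (x @ \oo).
  apply/cauchy_cvgP/cauchy_exP => e e00.
  have /cvgrPdist_lt/(_ e e00)/filter_ex[N] := cvg_geometric (2 * Q) z1.
  rewrite sub0r normrN => hN; exists (x N); exists N => // m /= Nm.
  rewrite -ball_normE/= distrC; apply: le_lt_trans (dist _ _ Nm) _.
  by apply: le_lt_trans (ler_norm _) hN.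
move=> /cvg_ex[l xl]; exists l; split=> // n; apply/ler_addgt0Pr => e e00.
have : \forall m \near \oo, `|l - x m| < e /\ (n <= m)%N.
  by near=> m; split; near: m; [move/cvgrPdist_lt: xl; apply|exact: nbhs_infty_ge].
move=> /filter_ex[m [lm nm]]; have := ler_distD (x m) l (x n); have := dist _ _ nm.
lra.
Unshelve. all: by end_near. Qed.

(** Points with |g t_n| > n would accumulate at some [l] of the compact interval; a selection
    converging to [l] contradicts boundedness of convergent sequences. *)
Lemma sequentially_bounded {W : normedModType R} (T : R) (g : R -> W) :
  (forall (t_ : nat -> R) (t : R), (forall n, t_ n \in `[0, T]) -> t \in `[0, T] ->
    t_ @ \oo --> t -> g \o t_ @ \oo --> g t) ->
  exists B : R, forall t, t \in `[0, T] -> `|g t| <= B.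
Proof.
move=> gc; apply: contrapT => nB.
have ex n : exists t, t \in `[0, T] /\ n%:R < `|g t|.
  apply: contrapT => h; apply: nB; exists n%:R => t tT.
  by rewrite leNgt; apply/negP => ?; apply: h; exists t.
have [t_ tP] := choice ex.
have [U [UU oU]] := @ultraFilterLemma nat \oo _.
have [|l _ hl] := @ultra_bounded_cvg R _ U t_ `|T| UU.
  apply: filterE => n /=; have := (tP n).1; rewrite in_itv/= => /andP[t0 tT].
  by rewrite !ger0_norm// (le_trans t0).
have sel i : exists n, (i <= n)%N /\ `|t_ n - l| < i.+1%:R^-1.
  have Ui : U [set n | (i <= n)%N] by apply: oU; exists i.
  by have [n [/= ? ?]] := proper_meet _ Ui (hl i.+1%:R^-1 ltac:(by [])); exists n.
have [s sP] := choice sel.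
have tl : (fun i => t_ (s i)) @ \oo --> l.
  apply/cvgrPdist_lt => e e0; have h := near_infty_natSinv_lt (PosNum e0).
  by apply: filterS h => i /=; rewrite distrC; apply: lt_trans; exact: (sP i).2.
have lT : l \in `[0, T].
  have cT : closed (`[0, T]%classic : set R) by exact: interval_closed.
  apply: (closed_cvg _ cT _ _ tl); apply: nearW => i; exact: (tP (s i)).1.
have [B hB] := cvg_norm_bounded (gc _ _ (fun i => (tP (s i)).1) lT tl).
have [n nB'] : exists n : nat, B < n%:R by exists (Num.bound `|B|);
    exact: le_lt_trans (ler_norm B) (archi_boundP (normr_ge0 B)).
have := (tP (s n)).2; rewrite ltNge => /negP; apply; apply: le_trans (hB n) _.
by apply: le_trans (ltW nB') _; rewrite ler_nat; exact: (sP n).1.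
Qed.

(** Integration gains the factor 1 / k, the source of the contraction in the weighted distance. *)
Lemma exp_integral_le (Q k t : R) : 0 <= Q -> 0 < k -> 0 < t ->
  (\int[lebesgue_measure]_(s in `]0%R, t[) (Q * expR (k * s))%:E <=
   (Q / k * expR (k * t))%:E)%E.
Proof.
move=> Q0 k0 t0.
pose F s := Q / k * expR (k * s).
have dF (s : R) : is_derive s 1 F (Q * expR (k * s)).
  rewrite /F; apply: is_derive_eq.
  rewrite /GRing.scale/= !mulr1.
  by field; rewrite gt_eqF.
have cont (h : R -> R) : (forall s : R, derivable h s 1) -> continuous h.
  by move=> dh s; apply: differentiable_continuous; apply/derivable1_diffP.
have cF : continuous F by apply: cont => s; case: (dF s).
have cf : continuous (fun s => Q * expR (k * s)).
  apply: cont => s; exact: ex_derive.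
apply: (@le_trans _ _ (\int[lebesgue_measure]_(s in `[0%R, t]) (Q * expR (k * s))%:E)%E).
  apply: ge0_subset_integral => //.
  - apply/measurable_EFinP; apply: measurable_funTS; exact: continuous_measurable_fun.
  - by move=> s _; rewrite lee_fin mulr_ge0// expR_ge0.
  - exact: subset_itv_oo_cc.
rewrite (@continuous_FTC2 _ _ F)//.
- by rewrite -EFinB lee_fin /F gerBl mulr_ge0 ?expR_ge0// divr_ge0// ltW.
- exact: continuous_subspaceT.
- split=> [s _||]; first by case: (dF s).
    by apply: cvg_at_right_filter; exact: cF.
  by apply: cvg_at_left_filter; exact: cF.
- by move=> s _; rewrite derive1E; case: (dF s).
Qed.

Lemma ae_imp (P Q : R -> Prop) : (forall t, P t -> Q t) ->
  {ae lebesgue_measure, forall t, P t} -> {ae lebesgue_measure, forall t, Q t}.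
Proof. by move=> PQ hP; apply: negligibleS hP => t /= nQ /PQ. Qed.

Lemma ae_and (P Q : R -> Prop) : {ae lebesgue_measure, forall t, P t} ->
  {ae lebesgue_measure, forall t, Q t} -> {ae lebesgue_measure, forall t, P t /\ Q t}.
Proof.
move=> hP hQ; apply: negligibleS (negligibleU hP hQ) => t /= nPQ.
by have [Pt|] := pselect (P t); [right=> Qt; exact: nPQ|left].
Qed.

End RealLemmas.

Section LebesgueBochner.
Context {R : realType} {T : R} {V : normedModType R}.
Local Notation mu := (@lebesgue_measure R).
Local Notation D := (`]0, T[%classic : set R).

Lemma itv_integrable_cst (c : R) : mu.-integrable D (EFin \o (fun=> c)).
Proof.
apply: (@integrableS _ _ _ mu `[0, T]%classic) => //.
  exact: subset_itv_oo_cc.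
apply: continuous_compact_integrable; first exact: segment_compact.
by apply: continuous_subspaceT => x; exact: cvg_cst.
Qed.

Lemma itv_integrableD (g h : R -> R) : mu.-integrable D (EFin \o g) ->
  mu.-integrable D (EFin \o h) -> mu.-integrable D (EFin \o (fun t => g t + h t)).
Proof. by move=> ig ih; apply: (integrableD _ ig ih). Qed.

Lemma itv_integrableZ (c : R) (g : R -> R) : mu.-integrable D (EFin \o g) ->
  mu.-integrable D (EFin \o (fun t => c * g t)).
Proof. by move=> ig; apply: (integrableZl _ c ig). Qed.

Lemma L2_strongly_measurable (u : L2 T V) : strongly_measurable D u.
Proof. exact: (L2funP u).1. Qed.

Let measurable_norm_sq (u : R -> V) : strongly_measurable D u ->
  measurable_fun D (fun t => (`|u t| ^+ 2)%:E).
Proof.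
move=> mu'; apply/measurable_EFinP.
have h := strongly_measurable_norm (measurable_itv _) mu'.
by apply: (measurable_funM h).
Qed.

Lemma L2_integrable_sq (u : L2 T V) : mu.-integrable D (EFin \o (fun t => `|u t| ^+ 2)).
Proof.
apply/integrableP; split; first exact: measurable_norm_sq (L2_strongly_measurable u).
under eq_integral do rewrite abse_EFin ger0_norm ?sqr_ge0//.
exact: (L2funP u).2.
Qed.

Lemma sq_integrable_le (u : R -> V) (g : R -> R) : strongly_measurable D u ->
  mu.-integrable D (EFin \o g) -> (forall t, t \in `]0, T[ -> `|u t| ^+ 2 <= g t) ->
  sq_integrable D u.
Proof.
move=> mu' ig ug; split=> //.
have : mu.-integrable D (fun t => (`|u t| ^+ 2)%:E).
  apply: le_integrable ig => //; first exact: measurable_norm_sq.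
  move=> t Dt; rewrite /= !lee_fin (ger0_norm (sqr_ge0 _)).
  by apply: le_trans (ug _ Dt) _; exact: ler_norm.
by move=> /integrableP[_]; under eq_integral do rewrite abse_EFin ger0_norm ?sqr_ge0//.
Qed.

Lemma L2_of_sq_integrable (u : R -> V) : sq_integrable D u ->
  exists U : L2 T V, {ae mu, forall t, t \in `]0, T[ -> U t = u t}.
Proof.
move=> su; pose u' := MkL2fun su; exists (\pi_(L2 T V)%qT u').
have : (\pi_(L2 T V)%qT (L2_repr (\pi_(L2 T V)%qT u')) = \pi_(L2 T V)%qT u').
  by rewrite /L2_repr reprK.
by move=> /eqmodP/asboolP.
Qed.

Lemma L2_integrable_dist (u v : L2 T V) :
  mu.-integrable D (EFin \o (fun t => `|u t - v t|)).
Proof.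
have mu' : strongly_measurable D (fun t => u t - v t).
  by apply: strongly_measurableB; exact: L2_strongly_measurable.
have h : mu.-integrable D (EFin \o (fun t => 1 + (2 * `|u t| ^+ 2 + 2 * `|v t| ^+ 2))).
  apply: itv_integrableD; first exact: itv_integrable_cst.
  by apply: itv_integrableD; apply: itv_integrableZ; exact: L2_integrable_sq.
apply: le_integrable h => //.
  apply/measurable_EFinP.
  exact: strongly_measurable_norm.
move=> t Dt; rewrite /= lee_fin normr_id.
apply: le_trans (ler_normB _ _) _; apply: le_trans (ler_norm _).
have := sqr_ge0 (`|u t| - 1); have := sqr_ge0 (`|v t| - 1).
have := sqr_ge0 (`|u t|); have := sqr_ge0 (`|v t|); lra.
Qed.

End LebesgueBochner.

(** * Fixed points of Volterra operators *)

Section VolterraContraction.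
Context {R : realType} {T : R} {V : completeNormedModType R}.
Local Notation mu := (@lebesgue_measure R).
Local Notation D := (`]0, T[%classic : set R).

Let measurable_dist (u v : L2 T V) (t : R) : t \in `]0, T[ ->
  measurable_fun `]0, t[ (fun s => `|u s - v s|%:E).
Proof.
rewrite in_itv/= => /andP[_ tT].
have [h _] := @integrableP _ _ _ _ _ _ (L2_integrable_dist u v).
apply: measurable_funS h => //.
by apply: subset_itvl; rewrite bnd_simp ltW.
Qed.

Let Rintegral_le (u v : L2 T V) (t c : R) :
  (\int[mu]_(s in `]0%R, t[) (`|u s - v s|)%:E <= c%:E)%E ->
  \int[mu]_(s in `]0, t[) `|u s - v s| <= c.
Proof.
move=> h; rewrite -lee_fin /Rintegral fineK// ge0_fin_numE.
  exact: le_lt_trans h (ltry _).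
by apply: integral_ge0 => s _; rewrite lee_fin.
Qed.

Let Rintegral_exp_le (u v : L2 T V) (Q k t : R) : 0 <= Q -> 0 < k -> t \in `]0, T[ ->
  {ae mu, forall s, s \in `]0, T[ -> `|u s - v s| <= Q * expR (k * s)} ->
  \int[mu]_(s in `]0, t[) `|u s - v s| <= Q / k * expR (k * t).
Proof.
move=> Q0 k0 tD uv; have /andP[t0 tT] : (0 < t) && (t < T) by rewrite in_itv in tD.
apply: Rintegral_le; apply: le_trans (exp_integral_le Q0 k0 t0).
apply: ae_ge0_le_integral => //.
- exact: measurable_dist.
- by move=> s _; rewrite lee_fin mulr_ge0// expR_ge0.
- apply/measurable_EFinP; apply: measurable_funTS; apply: continuous_measurable_fun.
  by move=> s; apply: differentiable_continuous; apply/derivable1_diffP; exact: ex_derive.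
- apply: ae_imp uv => s h; rewrite /= in_itv/= => /andP[s0 st].
  by rewrite lee_fin; apply: h; rewrite in_itv/= s0 (lt_trans st).
Qed.

Lemma volterra_initial (u v : L2 T V) : exists2 Q : R, 0 <= Q &
  forall t, t \in `]0, T[ -> \int[mu]_(s in `]0, t[) `|u s - v s| <= Q.
Proof.
exists (\int[mu]_(s in D) `|u s - v s|); first by apply: Rintegral_ge0.
move=> t tD; apply: Rintegral_le.
rewrite /Rintegral fineK; last first.
  by apply: integrable_fin_num => //; exact: L2_integrable_dist.
apply: ge0_subset_integral => //.
- by have [] := @integrableP _ _ _ _ _ _ (L2_integrable_dist u v).
- by apply: subset_itvl; move: tD; rewrite in_itv/= => /andP[_ tT]; rewrite bnd_simp ltW.
Qed.

Variables (Lam : L2 T V -> L2 T V) (C : R).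
Hypothesis C_gt0 : 0 < C.
Hypothesis Lam_hist : forall u v, {ae mu, forall t, t \in `]0, T[ ->
  `|Lam u t - Lam v t| <= C * \int[mu]_(s in `]0, t[) `|u s - v s|}.

(** Chosen so that the factor C / k is one half. *)
Let k := 2 * C.
(** The weighted supremum distance of two elements of L^2 may be infinite, so it appears as a
    relation with an explicit bound; between images of [Lam] such a bound exists. *)
Let close (Q : R) (u v : R -> V) :=
  {ae mu, forall t, t \in `]0, T[ -> `|u t - v t| <= Q * expR (k * t)}.

(* Bielecki's trick: [Lam] halves distances measured with the weight [expR (k * t)]. *)
Let Lam_halves (u v : L2 T V) Q : 0 <= Q -> close Q u v -> close (Q / 2) (Lam u) (Lam v).
Proof.
move=> Q0 uv; have k0 : 0 < k by rewrite /k mulr_gt0.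
apply: ae_imp (Lam_hist u v) => t h tD; apply: le_trans (h tD) _.
have := Rintegral_exp_le Q0 k0 tD uv => hI.
apply: le_trans (ler_wpM2l (ltW C_gt0) hI) _.
rewrite le_eqVlt; apply/predU1P; left; rewrite /k; field.
by rewrite gt_eqF.
Qed.

Let Lam_close (u v : L2 T V) : exists2 Q : R, 0 <= Q & close Q (Lam u) (Lam v).
Proof.
have [Q Q0 hQ] := volterra_initial u v; exists (C * Q); first by rewrite mulr_ge0// ltW.
apply: ae_imp (Lam_hist u v) => t h tD; apply: le_trans (h tD) _.
apply: (@le_trans _ _ (C * Q)); first by rewrite ler_wpM2l ?(ltW C_gt0)// hQ.
rewrite ler_peMr ?mulr_ge0 ?(ltW C_gt0)// -expR0 ler_expR.
by move: tD; rewrite in_itv/= => /andP[t0 _]; rewrite !mulr_ge0// ltW.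
Qed.

Let close_eq (u v : L2 T V) (Q : R) : (forall n, close (Q * (1 / 2) ^+ n) u v) -> u = v.
Proof.
move=> h; apply/L2_eqP; have := ae_foralln h; apply: ae_imp => t ht Dt.
apply/eqP; rewrite -subr_eq0 -normr_le0; apply: (@geometric_le0 _ _ (Q * expR (k * t))) => n.
by apply: le_trans (ht n Dt) _; rewrite mulrAC.
Qed.

Let half_ge0 n : 0 <= (1 / 2 : R) ^+ n. Proof. by rewrite exprn_ge0//; lra. Qed.

Lemma volterra_unique (u v : L2 T V) : Lam u = u -> Lam v = v -> u = v.
Proof.
move=> uu vv; have [Q Q0 hQ] := Lam_close u v; rewrite uu vv in hQ.
apply: (@close_eq _ _ Q); elim=> [|n IH]; first by rewrite expr0 mulr1.
have := Lam_halves (mulr_ge0 Q0 (half_ge0 n)) IH; rewrite uu vv exprS.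
by congr close; lra.
Qed.

Hypothesis V_sep : separable V.

Lemma volterra_exists : exists u, Lam u = u.
Proof.
have [u0 _] : exists U : L2 T V, {ae mu, forall t, t \in `]0, T[ -> U t = 0}.
  apply: (@L2_of_sq_integrable _ _ _ (fun=> 0)).
  apply: (@sq_integrable_le _ _ _ _ (fun=> 0)) => [||t _].
  - exact: strongly_measurable_cst.
  - exact: integrable0.
  - by rewrite normr0 expr0n.
(* The sequence [v] starts at the first iterate: only images of [Lam] are known to be at finite
   weighted distance. *)
pose w n := iter n Lam u0; pose v n := w n.+1.
have [Q Q0 hQ] := Lam_close (w 1%N) (w 0%N).
have vQ n : close (Q * (1 / 2) ^+ n) (v n.+1) (v n).
  elim: n => [|n IH]; first by rewrite expr0 mulr1.
  by have := Lam_halves (mulr_ge0 Q0 (half_ge0 n)) IH; rewrite exprS; congr close; lra.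
pose Q' := Q * expR (k * T).
have Q'0 : 0 <= Q' by rewrite mulr_ge0// expR_ge0.
(* One measurable null set serves all [n]. Setting the functions to 0 on it yields convergence at
   every point of [D], as strong measurability of the limit requires. *)
have [N [mN N0 hN]] := ae_foralln vQ.
have vQ' t n : t \in `]0, T[ -> ~ N t -> `|v n.+1 t - v n t| <= Q' * (1 / 2) ^+ n.
  move=> tD nNt; have /(_ n tD) h : forall n, t \in `]0, T[ ->
      `|v n.+1 t - v n t| <= Q * (1 / 2) ^+ n * expR (k * t).
    by apply: contrapT => h; apply: nNt; apply: hN.
  apply: le_trans h _; rewrite -mulrA [_ * expR _]mulrC mulrA.
  rewrite ler_wpM2r// ler_wpM2l// ler_expR ler_wpM2l ?mulr_ge0 ?(ltW C_gt0)//.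
  by move: tD; rewrite in_itv/= => /andP[_ /ltW].
have lim_ex t : exists l, t \in `]0, T[ -> ~ N t ->
    (fun n => v n t) @ \oo --> l /\ forall n, `|l - v n t| <= 2 * Q' * (1 / 2) ^+ n.
  have [tD|ntD] := boolP (t \in `]0, T[); last by exists 0.
  have [Nt|nNt] := pselect (N t); first by exists 0.
  by have [l hl] := geometric_cvg (fun n => vQ' t n tD nNt); exists l.
have [l lP] := choice lim_ex.
pose u t := if t \in N then 0 else l t.
have mD : measurable (`]0, T[%classic : set R) by [].
have mu' : strongly_measurable D u.
  apply: (@strongly_measurable_limit _ _ mD _ (fun n t => if t \in N then 0 else v n t)).
  - exact: V_sep.
  - move=> n; apply: strongly_measurable_if => //; first exact: strongly_measurable_cst.
    exact: L2_strongly_measurable.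
  - move=> t Dt; rewrite /u; have [Nt|nNt] := pselect (N t).
      by rewrite mem_set//; exact: cvg_cst.
    by rewrite memNset//; exact: (lP t Dt nNt).1.
have [U hU] : exists U : L2 T V, {ae mu, forall t, t \in `]0, T[ -> U t = u t}.
  apply: L2_of_sq_integrable; apply: (@sq_integrable_le _ _ _ _
    (fun t => 8 * Q' ^+ 2 + 2 * `|v 0%N t| ^+ 2)) => //.
    apply: itv_integrableD; first exact: itv_integrable_cst.
    by apply: itv_integrableZ; exact: L2_integrable_sq.
  move=> t Dt; rewrite /u; have [Nt|nNt] := pselect (N t).
    by rewrite mem_set// normr0 expr0n/= addr_ge0// mulr_ge0// sqr_ge0.
  rewrite memNset//; have := (lP t Dt nNt).2 0%N; rewrite expr0 mulr1 => h.
  have hl : `|l t| <= 2 * Q' + `|v 0%N t|.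
    by have := ler_distD (v 0%N t) (l t) 0; rewrite !subr0; lra.
  apply: (@le_trans _ _ ((2 * Q' + `|v 0%N t|) ^+ 2)).
    by rewrite lerXn2r ?nnegrE// addr_ge0// mulr_ge0.
  by have := sqr_ge0 (2 * Q' - `|v 0%N t|); lra.
exists U.
have Uv n : close (2 * Q' * (1 / 2) ^+ n) U (v n).
  have nN : {ae mu, forall t, ~ N t}.
    by exists N; split=> // t /=; exact: contrapT.
  apply: ae_imp (ae_and hU nN) => t [Ut nNt] tD; rewrite (Ut tD) /u memNset//.
  apply: le_trans ((lP t tD nNt).2 n) _.
  rewrite ler_peMr ?mulr_ge0// -expR0 ler_expR !mulr_ge0 ?(ltW C_gt0)//.
  by move: tD; rewrite in_itv/= => /andP[/ltW].
have Q2 n : 0 <= 2 * Q' * (1 / 2) ^+ n by rewrite !mulr_ge0.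
(* [Lam U] and [U] are each within Q' (1/2)^n of v n.+1 = Lam (v n): one by halving the distance at
   [n], the other by the estimate at n + 1. *)
apply: (@close_eq _ _ (2 * Q')) => n.
have h1 := Lam_halves (Q2 n) (Uv n); have h2 := Uv n.+1.
apply: ae_imp (ae_and h1 h2) => t [/= a1 a2] tD.
have := a1 tD; have := a2 tD; rewrite (distrC (U t)).
have := ler_distD (v n.+1 t) (Lam U t) (U t); rewrite exprS.
lra.
Qed.

End VolterraContraction.

(** * The history-dependent inequality *)

Section HistoryFixedPoint.
Context {R : realType} {T : R} {E X Y Z : normedModType R} {V : completeNormedModType R}.
Local Notation mu := (@lebesgue_measure R).
Local Notation P := (E * X * Y * Z)%type.
Context (F : R -> P -> V) (L cR1 cR2 cR3 cR4 : R).
Context (R1 : L2 T V -> L2 T E) (R2 : L2 T V -> L2 T X).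
Context (R3 : L2 T V -> L2 T Y) (R4 : L2 T V -> L2 T Z).
Hypothesis V_sep : separable V.
Hypothesis L_ge0 : 0 <= L.
Hypothesis F_cvg : forall (t_ : nat -> R) (t : R) (p_ : nat -> P) (p : P),
  (forall n, t_ n \in `[0, T]) -> t \in `[0, T] ->
  t_ @ \oo --> t -> p_ @ \oo --> p -> (fun n => F (t_ n) (p_ n)) @ \oo --> F t p.
Hypothesis F_lip : forall t p q, t \in `[0, T] -> `|F t p - F t q| <= L * `|p - q|.
Hypothesis cR1_gt0 : 0 < cR1.
Hypothesis cR2_gt0 : 0 < cR2.
Hypothesis cR3_gt0 : 0 < cR3.
Hypothesis cR4_gt0 : 0 < cR4.
Hypothesis R1_hist : forall v1 v2, {ae mu, forall t, t \in `]0, T[ ->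
  `|R1 v1 t - R1 v2 t| <= cR1 * \int[mu]_(s in `]0, t[) `|v1 s - v2 s|}.
Hypothesis R2_hist : forall v1 v2, {ae mu, forall t, t \in `]0, T[ ->
  `|R2 v1 t - R2 v2 t| <= cR2 * \int[mu]_(s in `]0, t[) `|v1 s - v2 s|}.
Hypothesis R3_hist : forall v1 v2, {ae mu, forall t, t \in `]0, T[ ->
  `|R3 v1 t - R3 v2 t| <= cR3 * \int[mu]_(s in `]0, t[) `|v1 s - v2 s|}.
Hypothesis R4_hist : forall v1 v2, {ae mu, forall t, t \in `]0, T[ ->
  `|R4 v1 t - R4 v2 t| <= cR4 * \int[mu]_(s in `]0, t[) `|v1 s - v2 s|}.

Let history (w : L2 T V) t : P := (R1 w t, R2 w t, R3 w t, R4 w t).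

Let itv_oo_cc t : t \in `]0, T[ -> t \in `[0, T].
Proof. exact: subset_itv_oo_cc. Qed.

Let superposition w : exists W : L2 T V,
  {ae mu, forall t, t \in `]0, T[ -> W t = F t (history w t)}.
Proof.
have [B hB] : exists B : R, forall t, t \in `[0, T] -> `|F t 0| <= B.
  apply: (sequentially_bounded (g := F ^~ 0)) => t_ t tT tT' tt.
  by apply: F_cvg => //; exact: cvg_cst.
pose sq t := `|R1 w t| ^+ 2 + (`|R2 w t| ^+ 2 + (`|R3 w t| ^+ 2 + `|R4 w t| ^+ 2)).
apply: L2_of_sq_integrable.
(* With S the sum of the four norms, (B + L S)^2 <= 2 B^2 + 2 L^2 S^2, and S^2 is at most four times
   the sum of squares. *)
apply: (@sq_integrable_le _ _ _ _ (fun t => 2 * B ^+ 2 + 8 * L ^+ 2 * sq t)).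
- have DT : `]0, T[%classic `<=` (`[0, T]%classic : set R) by exact: subset_itv_oo_cc.
  have mp : strongly_measurable `]0, T[%classic (history w).
    by do !apply: strongly_measurable_pair; exact: L2_strongly_measurable.
  apply: (strongly_measurable_caratheodory _ DT _ mp); first by [].
  by move=> t_ p_ t Dt tT tt pp; apply: F_cvg => //; exact: itv_oo_cc.
- apply: itv_integrableD; first exact: itv_integrable_cst.
  by apply: itv_integrableZ; do !apply: itv_integrableD; exact: L2_integrable_sq.
move=> t tD; have tT := itv_oo_cc tD; rewrite /sq.
have := norm_quadruple_sum (history w t); rewrite /history/=.
set a := `|R1 w t|; set b := `|R2 w t|; set c := `|R3 w t|; set d := `|R4 w t|.
set p := (_, _, _, _) => hp.
have h : `|F t p| <= B + L * (a + b + c + d).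
  have := F_lip p 0 tT; have := hB _ tT; rewrite subr0.
  have := ler_distD (F t 0) (F t p) 0; rewrite !subr0.
  have := ler_wpM2l L_ge0 hp; lra.
apply: (@le_trans _ _ ((B + L * (a + b + c + d)) ^+ 2)).
  by rewrite lerXn2r ?nnegrE// (le_trans _ h).
have h1 := sqr_ge0 (B - L * (a + b + c + d)).
have h2 : (a + b + c + d) ^+ 2 <= 4 * (a ^+ 2 + (b ^+ 2 + (c ^+ 2 + d ^+ 2))).
  have := sqr_ge0 (a - b); have := sqr_ge0 (a - c); have := sqr_ge0 (a - d).
  have := sqr_ge0 (b - c); have := sqr_ge0 (b - d); have := sqr_ge0 (c - d); lra.
have := ler_wpM2l (sqr_ge0 L) h2; move: h1; lra.
Qed.

Theorem history_fixed_point : exists! w : L2 T V,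
  {ae mu, forall t, t \in `]0, T[ -> w t = F t (R1 w t, R2 w t, R3 w t, R4 w t)}.
Proof.
have [Lam hLam] := choice superposition.
(* The added 1 keeps [C] positive when [L] is 0. *)
pose C := L * (cR1 + cR2 + cR3 + cR4) + 1.
have c0 : 0 <= cR1 + cR2 + cR3 + cR4 by rewrite !addr_ge0// ltW.
have C0 : 0 < C by rewrite /C ltr_wpDl// mulr_ge0.
have Lam_hist u v : {ae mu, forall t, t \in `]0, T[ ->
    `|Lam u t - Lam v t| <= C * \int[mu]_(s in `]0, t[) `|u s - v s|}.
  have := ae_and (ae_and (hLam u) (hLam v)) (ae_and (ae_and (R1_hist u v) (R2_hist u v))
    (ae_and (R3_hist u v) (R4_hist u v))).
  apply: ae_imp => t [[Fu Fv] [[h1 h2] [h3 h4]]] tD; rewrite (Fu tD) (Fv tD).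
  apply: le_trans (F_lip _ _ (itv_oo_cc tD)) _.
  have I0 : 0 <= \int[mu]_(s in `]0, t[) `|u s - v s| by apply: Rintegral_ge0.
  have := norm_quadruple_sum (history u t - history v t).
  have := h1 tD; have := h2 tD; have := h3 tD; have := h4 tD; rewrite /C /=.
  set I := Rintegral _ _ _ in I0 *.
  move=> k4 k3 k2 k1 hp; have : `|history u t - history v t| <= (cR1 + cR2 + cR3 + cR4) * I.
    by apply: le_trans hp _; lra.
  by move=> /(ler_wpM2l L_ge0); lra.
have fix_ae w : Lam w = w <-> {ae mu, forall t, t \in `]0, T[ -> w t = F t (history w t)}.
  split=> [Lw|hw]; first by have := hLam w; rewrite Lw.
  by apply/L2_eqP; apply: ae_imp (ae_and (hLam w) hw) => t [/= h1 h2] tD; rewrite h1// h2.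
have [w Lw] := volterra_exists C0 Lam_hist V_sep.
exists w; split; first exact/fix_ae.
move=> w' hw'; have Lw' : Lam w' = w' by apply/fix_ae.
exact: (volterra_unique C0 Lam_hist Lw Lw').
Qed.

End HistoryFixedPoint.

(** For each point of a dense sequence and each radius 1 / (j + 1), choose a point of [K] in that
    ball if there is one, and [k0] otherwise. *)
Lemma separable_subset_seq {R : realType} {V : normedModType R} (K : set V) :
  separable V -> K !=set0 -> exists k : nat -> V,
    (forall n, K (k n)) /\ forall x e, K x -> 0 < e -> exists n, `|x - k n| < e.
Proof.
move=> V_sep [k0 Kk0]; have [d dP] := separable_seq V_sep.
have ex (ij : nat * nat) : exists c, K c /\
    ((exists2 x, K x & `|x - d ij.1| < ij.2.+1%:R^-1) -> `|c - d ij.1| < ij.2.+1%:R^-1).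
  have [[x Kx xd]|h] := pselect (exists2 x, K x & `|x - d ij.1| < ij.2.+1%:R^-1).
    by exists x.
  by exists k0; split=> // /h.
have [c cP] := choice ex.
exists (fun n => c (odflt (0, 0)%N (unpickle n))); split=> [n|x e Kx e0].
  exact: (cP _).1.
have e2 : 0 < e / 2 by rewrite divr_gt0.
have /filter_ex[j je] := near_infty_natSinv_lt (PosNum e2).
have [i xi] := dP x j.+1%:R^-1 ltac:(by []).
exists (pickle (i, j)); rewrite pickleK/=.
have := (cP (i, j)).2 (ex_intro2 _ _ x Kx xi) => /= ci.
have := ler_distD (d i) x (c (i, j)); rewrite (distrC (d i)).
have := lt_trans xi je; have := lt_trans ci je => /=; lra.
Qed.

Theorem theorem5 (R : realType) (T : R) (E X Y Z V : completeNormedModType R)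
  (A : R -> E -> V -> dual R V) (f : R -> X -> dual R V)
  (phi : R -> Y -> V -> V -> R) (j : R -> Z -> X -> R)
  (K : set V) (M : bounded_op V X)
  (R1 : L2 T V -> L2 T E) (R2 : L2 T V -> L2 T X)
  (R3 : L2 T V -> L2 T Y) (R4 : L2 T V -> L2 T Z)
  (a0 : R -> R) (a1 a2 mA mA' Lf : R)
  (alpha_phi beta_phi : R) (c_phi1 c_phi2 : R -> R) (c3 : R)
  (c0j : R -> R) (c1j c2j mj m1 cR1 cR2 cR3 cR4 : R)
  (T_gt0 : 0 < T)
  (E_sep : separable E) (X_sep : separable X) (Y_sep : separable Y)
  (Z_sep : separable Z) (V_sep : separable V) (V_refl : reflexive_space V)
  (* operator A *)
  (A_cont : forall v,
    {within `[0, T]%classic `*` [set: E], continuous (fun p => A p.1 p.2 v)})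
  (a0_cont : {within `[0, T]%classic, continuous a0})
  (a0_ge0 : forall t, t \in `[0, T] -> 0 <= a0 t)
  (a1_ge0 : 0 <= a1) (a2_ge0 : 0 <= a2)
  (A_growth : forall t l v, t \in `[0, T] ->
    `|A t l v| <= a0 t + a1 * `|l| + a2 * `|v|)
  (A_demi : forall t l, t \in `[0, T] -> demicontinuous (A t l))
  (mA_gt0 : 0 < mA) (mA'_ge0 : 0 <= mA')
  (A_mono : forall t l1 l2 v1 v2, t \in `[0, T] ->
    mA * `|v1 - v2| ^+ 2 - mA' * `|l1 - l2| * `|v1 - v2| <=
    <| A t l1 v1 - A t l2 v2, v1 - v2 |>)
  (* function f *)
  (f_cont : forall xi, {within `[0, T]%classic, continuous (f ^~ xi)})
  (Lf_gt0 : 0 < Lf)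
  (f_lip : forall t xi1 xi2, t \in `[0, T] ->
    `|f t xi1 - f t xi2| <= Lf * `|xi1 - xi2|)
  (* function phi *)
  (phi_convex : forall t eta w, t \in `[0, T] ->
    convex_function [set: convex_lmodType V] (phi t eta w))
  (phi_lsc : forall t eta w, t \in `[0, T] ->
    lower_semicontinuous (EFin \o phi t eta w))
  (alpha_phi_ge0 : 0 <= alpha_phi) (beta_phi_ge0 : 0 <= beta_phi)
  (phi_ineq : forall t eta1 eta2 w1 w2 v1 v2, t \in `[0, T] ->
    phi t eta1 w1 v2 - phi t eta1 w1 v1 + phi t eta2 w2 v1 - phi t eta2 w2 v2 <=
    alpha_phi * `|w1 - w2| * `|v1 - v2| + beta_phi * `|eta1 - eta2| * `|v1 - v2|)
  (c_phi1_cont : {within `[0, T]%classic, continuous c_phi1})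
  (c_phi1_ge0 : forall t, t \in `[0, T] -> 0 <= c_phi1 t)
  (c_phi2_cont : {within `[0, +oo[%classic, continuous c_phi2})
  (c_phi2_ge0 : forall r, 0 <= r -> 0 <= c_phi2 r)
  (c3_gt0 : 0 < c3)
  (phi_lip : forall t eta w v1 v2, t \in `[0, T] ->
    phi t eta w v1 - phi t eta w v2 <=
    (c_phi1 t + c_phi2 `|w| + c3 * `|eta|) * `|v1 - v2|)
  (phi_limsup : forall v (t_ : nat -> R) t (eta_ : nat -> Y) eta (w_ : nat -> V) w,
    (forall n, t_ n \in `[0, T]) -> t \in `[0, T] ->
    t_ @ \oo --> t -> eta_ @ \oo --> eta -> weak_cvg w_ w ->
    (limn_esup (fun n => (phi (t_ n) (eta_ n) (w_ n) v
                          - phi (t_ n) (eta_ n) (w_ n) (w_ n))%:E) <=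
     (phi t eta w v - phi t eta w w)%:E)%E)
  (* function j *)
  (j_cont : forall v,
    {within `[0, T]%classic `*` [set: Z], continuous (fun p => j p.1 p.2 v)})
  (j_loclip : forall t zeta, t \in `[0, T] -> locally_lipschitz (j t zeta))
  (c0j_cont : {within `[0, T]%classic, continuous c0j})
  (c0j_ge0 : forall t, t \in `[0, T] -> 0 <= c0j t)
  (c1j_ge0 : 0 <= c1j) (c2j_ge0 : 0 <= c2j)
  (j_growth : forall t zeta v, t \in `[0, T] ->
    (set_norm (clarke_subdiff (j t zeta) v) <=
     (c0j t + c1j * `|zeta| + c2j * `|v|)%:E)%E)
  (mj_ge0 : 0 <= mj) (m1_ge0 : 0 <= m1)
  (j_ineq : forall t zeta1 zeta2 v1 v2, t \in `[0, T] ->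
    clarke_deriv (j t zeta1) v1 (v2 - v1) + clarke_deriv (j t zeta2) v2 (v1 - v2) <=
    mj * `|v1 - v2| ^+ 2 + m1 * `|zeta1 - zeta2| * `|v1 - v2|)
  (j_limsup : forall v (t_ : nat -> R) t (zeta_ : nat -> Z) zeta (w_ : nat -> V) w,
    (forall n, t_ n \in `[0, T]) -> t \in `[0, T] ->
    t_ @ \oo --> t -> zeta_ @ \oo --> zeta -> weak_cvg w_ w ->
    (limn_esup (fun n =>
       (clarke_deriv (j (t_ n) (zeta_ n)) (M v) (M v - M (w_ n)))%:E) <=
     (clarke_deriv (j t zeta) (M v) (M v - M w))%:E)%E)
  (* constraint set K and operator M *)
  (K_neq0 : K !=set0) (K_closed : closed K)
  (K_convex : convex_set (K : set (convex_lmodType V)))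
  (M_compact : compact_op M)
  (* history-dependent operators *)
  (cR1_gt0 : 0 < cR1) (cR2_gt0 : 0 < cR2) (cR3_gt0 : 0 < cR3) (cR4_gt0 : 0 < cR4)
  (R1_hist : forall v1 v2, {ae lebesgue_measure, forall t, t \in `]0, T[ ->
    `|R1 v1 t - R1 v2 t| <=
    cR1 * \int[lebesgue_measure]_(s in `]0, t[) `|v1 s - v2 s|})
  (R2_hist : forall v1 v2, {ae lebesgue_measure, forall t, t \in `]0, T[ ->
    `|R2 v1 t - R2 v2 t| <=
    cR2 * \int[lebesgue_measure]_(s in `]0, t[) `|v1 s - v2 s|})
  (R3_hist : forall v1 v2, {ae lebesgue_measure, forall t, t \in `]0, T[ ->
    `|R3 v1 t - R3 v2 t| <=
    cR3 * \int[lebesgue_measure]_(s in `]0, t[) `|v1 s - v2 s|})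
  (R4_hist : forall v1 v2, {ae lebesgue_measure, forall t, t \in `]0, T[ ->
    `|R4 v1 t - R4 v2 t| <=
    cR4 * \int[lebesgue_measure]_(s in `]0, t[) `|v1 s - v2 s|})
  (smallness : mj * `|M| ^+ 2 + alpha_phi < mA) :
  exists! w : L2 T V,
    {ae lebesgue_measure, forall t, t \in `]0, T[ -> K (w t)} /\
    forall v, K v -> {ae lebesgue_measure, forall t, t \in `]0, T[ ->
      0 <= <| A t (R1 w t) (w t) - f t (R2 w t), v - w t |>
           + phi t (R3 w t) (w t) v - phi t (R3 w t) (w t) (w t)
           + clarke_deriv (j t (R4 w t)) (M (w t)) (M v - M (w t))}.
Proof.
have oo_cc t : t \in `]0, T[ -> t \in `[0, T] by exact: subset_itv_oo_cc.
pose P := (E * X * Y * Z)%type.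
have sol_ex (t : R) (p : P) : t \in `[0, T] -> exists w, solves A f phi j K M t p w.
  exact: solution_exists V_refl A_demi mA'_ge0 A_mono Lf_gt0 f_lip phi_convex beta_phi_ge0
    phi_ineq phi_lip phi_limsup j_loclip j_growth mj_ge0 m1_ge0 j_ineq K_neq0 K_closed
    K_convex smallness _ p.
have sol_unique (t : R) (p : P) w1 w2 : t \in `[0, T] ->
    solves A f phi j K M t p w1 -> solves A f phi j K M t p w2 -> w1 = w2.
  exact: solution_unique mA'_ge0 A_mono Lf_gt0 f_lip beta_phi_ge0 phi_ineq mj_ge0 m1_ge0
    j_ineq smallness _ _ _ _.
have [L L0 hL] := solution_lipschitz K mA'_ge0 A_mono Lf_gt0 f_lip beta_phi_ge0
  phi_ineq mj_ge0 m1_ge0 j_ineq smallness.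
(* Made total in time, with value 0 off [0,T], so that choice gives a function on all pairs. *)
have sol_ex' (tp : R * P) : exists w, tp.1 \in `[0, T] ->
    solves A f phi j K M tp.1 tp.2 w.
  have [tT|ntT] := boolP (tp.1 \in `[0, T]); last by exists 0.
  by have [w hw] := sol_ex tp.1 tp.2 tT; exists w.
have [S hS] := choice sol_ex'.
pose F t p := S (t, p).
have hF (t : R) (p : P) : t \in `[0, T] -> solves A f phi j K M t p (F t p).
  exact: (hS (t, p)).
have F_cvg (t_ : nat -> R) (t : R) (p_ : nat -> P) (p : P) :
    (forall n, t_ n \in `[0, T]) -> t \in `[0, T] ->
    t_ @ \oo --> t -> p_ @ \oo --> p -> (fun n => F (t_ n) (p_ n)) @ \oo --> F t p.
  move=> tT tT' tt pp.
  have sn n : solves A f phi j K M (t_ n) (p_ n) (F (t_ n) (p_ n)) by exact: hF.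
  have st : solves A f phi j K M t p (F t p) by exact: hF.
  exact: (solution_cvg V_sep V_refl A_cont A_demi mA'_ge0 A_mono f_cont Lf_gt0 f_lip
    phi_convex alpha_phi_ge0 beta_phi_ge0 phi_ineq c_phi1_cont phi_lip phi_limsup j_loclip
    c0j_cont j_growth mj_ge0 m1_ge0 j_ineq j_limsup K_neq0 K_closed K_convex smallness
    tT tT' tt pp sn st).
have F_lip t p q : t \in `[0, T] -> `|F t p - F t q| <= L * `|p - q|.
  by move=> tT; exact: (hL _ _ _ _ _ tT (hF _ _ tT) (hF _ _ tT)).
have [w [hw w_uniq]] := history_fixed_point V_sep L0 F_cvg F_lip cR1_gt0 cR2_gt0 cR3_gt0
  cR4_gt0 R1_hist R2_hist R3_hist R4_hist.
exists w; split.
  have sw : {ae lebesgue_measure, forall t, t \in `]0, T[ ->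
      solves A f phi j K M t (R1 w t, R2 w t, R3 w t, R4 w t) (w t)}.
    by apply: ae_imp hw => t h tD; rewrite h//; exact/hF/oo_cc.
  split; first by apply: ae_imp sw => t h tD; exact: (h tD).1.
  by move=> v Kv; apply: ae_imp sw => t h tD; exact: (h tD).2.
(* Outside one null set the inequality for [w'] holds against every [k n]; by [solves_dense] it then
   holds on [K], so [w' t] solves the problem at time [t] and equals the value of [F]. *)
move=> w' [Kw' hw']; apply: w_uniq.
have [k [Kk kP]] := separable_subset_seq V_sep K_neq0.
have hk := ae_foralln (fun n => hw' (k n) (Kk n)).
apply: ae_imp (ae_and Kw' hk) => t [Kt ht] tD; have tT := oo_cc _ tD.
apply: (sol_unique _ _ _ _ tT _ (hF _ _ tT)).
apply: (solves_dense phi_lip j_loclip j_growth tT kP (Kt tD)).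
by move=> n; exact: ht.
Qed.
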